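(* Consider the closed-loop system on $(\mathsf{SO}(3))^N$ $$\dot{\mathbf{R}}_i=\boldsymbol{\Omega}_i\mathbf{R}_i,\qquad \boldsymbol{\Omega}_i=\mathbf{S}\Big(\mathbf{x}_i\times\mathbf{u}_i+\sum_{j\in\mathcal{N}_i}g_{ij}\,\mathbf{x}_i\Big),\qquad \mathbf{u}_i=\sum_{j\in\mathcal{N}_i}f_{ij}(1-\langle\mathbf{x}_i,\mathbf{x}_j\rangle)\,\mathbf{x}_j,\qquad i\in\mathcal{V},$$ over a connected undirected graph $\mathcal{G}=(\mathcal{V},\mathcal{E})$, with gains $f_{ij},g_{ij}$ as specified in the context. Suppose all feedback gains $g_{ij}$, for $\{i,j\}\in\mathcal{E}$, are chosen such that all equilibria of the great-circle system $$\dot{\mathbf{y}}_i=\sum_{j\in\mathcal{N}_i}g_{ij}\,\mathbf{z}_i,\qquad \dot{\mathbf{z}}_i=-\sum_{j\in\mathcal{N}_i}g_{ij}\,\mathbf{y}_i,\qquad i\in\mathcal{V},$$ (with $\mathbf{x}_i$ constant and $\mathbf{x}_i=\mathbf{x}_j$ for all $\{i,j\}\in\mathcal{E}$) are exponentially unstable except for those in the consensus set $$\mathcal{C}=\{(\mathbf{R}_i)_{i=1}^N\in(\mathsf{SO}(3))^N:\mathbf{R}_i=\mathbf{R}_j\ \text{ for all }\{i,j\}\in\mathcal{E}\}.$$ Then all equilibria of the closed-loop system on $(\mathsf{SO}(3))^N$ except those in $\mathcal{C}$ are exponentially unstable. Moreover, $\mathcal{C}$ is asymptotically stable.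
   Context: $\mathcal{G}=(\mathcal{V},\mathcal{E})$ is a simple, undirected, connected graph with $\mathcal{V}=\{1,\dots,N\}$, and $\mathcal{N}_i=\{j\in\mathcal{V}:\{i,j\}\in\mathcal{E}\}$. Write $\mathbf{R}_i=[\mathbf{x}_i\ \mathbf{y}_i\ \mathbf{z}_i]\in\mathsf{SO}(3)$, i.e. $\mathbf{x}_i=\mathbf{R}_i\mathbf{e}_1$, $\mathbf{y}_i=\mathbf{R}_i\mathbf{e}_2$, $\mathbf{z}_i=\mathbf{R}_i\mathbf{e}_3$ (so $\mathbf{z}_i=\mathbf{x}_i\times\mathbf{y}_i$), where $\mathbf{e}_1,\mathbf{e}_2,\mathbf{e}_3$ is the standard basis of $\mathbb{R}^3$. $\mathbf{S}:\mathbb{R}^3\to\mathsf{so}(3)$ is the linear bijection onto the skew-symmetric $3\times3$ matrices with $\mathbf{S}(\mathbf{a})\mathbf{b}=\mathbf{a}\times\mathbf{b}$. Gains $f_{ij}$: for each $\{i,j\}\in\mathcal{E}$, $f_{ij}:\mathbb{R}\to\mathbb{R}$ is real analytic and for all $s\in(0,2]$: $f_{ij}(s)>0$, $f_{ij}(s)=f_{ji}(s)$, and $s^2f_{ij}(s)-(2-s)s^2f_{ij}'(s)>0$. Gains $g_{ij}$: for each $\{i,j\}\in\mathcal{E}$, $g_{ij}$ is a real-valued locally Lipschitz function of the relative information available to agent $i$, namely $(\mathbf{R}_i^\top\mathbf{R}_k)_{k\in\mathcal{N}_i}$. The gains are required to be such that the great-circle system displayed in the claim reaches consensus for almost all initial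 conditions such that $\mathbf{x}_i(0)=\mathbf{x}_j(0)$ for all $\{i,j\}\in\mathcal{E}$. In that system $\mathbf{x}_i$ is constant and $\mathbf{z}_i=\mathbf{x}_i\times\mathbf{y}_i$, so the dynamics evolve over a single great circle of the unit sphere in $\mathbb{R}^3$ and $\mathbf{z}_i$ can be expressed in terms of $\mathbf{y}_i$. An equilibrium is exponentially unstable if the linearization of the dynamics at it has an eigenvalue with strictly positive real part. A set is asymptotically stable if it is Lyapunov stable and attracts all trajectories starting in some neighborhood of it.
   Formalization: ''Reaches consensus for almost all initial conditions'' also includes asymptotic stability of C in the great-circle system (the Moreover fails otherwise), and instability of closed-loop equilibria is claimed where the linearization exists (g_ij is only locally Lipschitz). *)

(* Defs.v *)
From mathcomp Require Export all_boot all_order all_algebra.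
From mathcomp Require Export all_classical all_reals all_analysis.
Export Order.TTheory GRing.Theory Num.Theory.
Export numFieldNormedType.Exports.

Set Implicit Arguments.
Unset Strict Implicit.
Unset Printing Implicit Defensive.

#[export] Set Implicit Arguments.
#[export] Unset Strict Implicit.
#[export] Unset Printing Implicit Defensive.

Local Open Scope classical_set_scope.
Local Open Scope ring_scope.

(* M is the state space, a subset (in the uses below, an embedded submanifold)
   of the normed space E.  Only the values of the vector field F on M matter. *)
Section Dynamics.
Variables (R : realType) (E : normedModType R).
Implicit Types (M C : set E) (F : E -> E) (X : R -> E) (p v : E).

Definition trajectory M F X :=
  [/\ {within [set t | 0 <= t], continuous X},
      forall t, 0 <= t -> M (X t) &
      forall t : R, 0 < t -> is_derive t (1 : R) X (F (X t))].

Definition equilibrium M F p := M p /\ F p = 0.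

Definition tangent M p v :=
  exists gamma : R -> E,
    [/\ gamma 0 = p, forall t, M (gamma t) & is_derive (0 : R) (1 : R) gamma v].

(* A is a derivative of F : M -> E at p, i.e. F q = F p + A (q - p) + o(q - p)
   as q tends to p within M.  Only the restriction of A to the tangent space of
   M at p is determined by F. *)
Definition linearization M F p (A : {linear E -> E}) :=
  forall eps, 0 < eps ->
    \forall q \near within M (nbhs p),
      `|F q - F p - A (q - p)| <= eps * `|q - p|.

Definition linearizable M F p := exists A, linearization M F p A.

(* The eigenvalue is a + i b; its eigenvector v + i w lies in the complexified
   tangent space.  The two equations are the real and imaginary parts of
   A (v + i w) = (a + i b) (v + i w). *)
Definition exponentially_unstable M F p :=
  exists2 A, linearization M F p A &
    exists (a b : R) (v w : E),
      [/\ 0 < a, tangent M p v, tangent M p w, ~ (v = 0 /\ w = 0) &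
          A v = a *: v - b *: w /\ A w = b *: v + a *: w].

Definition tube C (eps : R) : set E := \bigcup_(y in C) ball y eps.

Definition converges_to C X :=
  forall eps, 0 < eps -> \forall t \near +oo, tube C eps (X t).

Definition lyapunov_stable M F C :=
  forall eps, 0 < eps -> exists2 delta, 0 < delta &
    forall X, trajectory M F X -> tube C delta (X 0) ->
      forall t, 0 <= t -> tube C eps (X t).

Definition locally_attractive M F C :=
  exists2 delta, 0 < delta &
    forall X, trajectory M F X -> tube C delta (X 0) -> converges_to C X.

Definition asymptotically_stable M F C :=
  lyapunov_stable M F C /\ locally_attractive M F C.

End Dynamics.

(* Lebesgue-null subsets of R^n.  The norm on row vectors is the sup norm, so
   ball c r is an open cube of volume (2 r)^n. *)
Definition null_set (R : realType) n (A : set 'rV[R]_n) :=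
  forall eps : R, 0 < eps ->
    exists (c : nat -> 'rV[R]_n) (r : nat -> R),
      [/\ forall k, 0 <= r k, A `<=` \bigcup_k ball (c k) (r k) &
          (\sum_(0 <= k <oo) ((2 * r k) ^+ n)%:E <= eps%:E)%E].

Definition real_analytic (R : realType) (f : R -> R) :=
  forall x, exists (a : nat -> R) (r : R), 0 < r /\
    forall h, `|h| < r -> pseries a h @ \oo --> f (x + h).

Section Attitudes.
Variable R : realType.

Definition SO3 : set 'M[R]_3 := [set Q | Q^T *m Q = 1%:M /\ \det Q = 1].

Definition spin (a : 'cV[R]_3) : 'M[R]_3 :=
  let a1 := a 0 0 in let a2 := a 1 0 in let a3 := a 2 0 in
  \matrix_(i, j) (nth [::] [:: [::   0; - a3;   a2];
                               [::  a3;    0; - a1];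
                               [:: - a2;  a1;    0]] i)`_j.

Definition cross (a b : 'cV[R]_3) : 'cV[R]_3 := spin a *m b.

Definition dot (a b : 'cV[R]_3) : R := (a^T *m b) 0 0.

Definition rot1 (theta : R) : 'M[R]_3 :=
  \matrix_(i, j) (nth [::] [:: [:: 1;         0;             0];
                               [:: 0; cos theta; - sin theta];
                               [:: 0; sin theta;   cos theta]] i)`_j.

Variable N : nat.

(* An N-tuple of 3 x 3 matrices is stored as one matrix with the entries of the
   i-th member in row i, which makes the space of tuples a normed space. *)
Definition config := 'M[R]_(N, 3 * 3).

Definition tuple_mx (Q : 'I_N -> 'M[R]_3) : config := \matrix_i mxvec (Q i).

Definition att (X : config) (i : 'I_N) : 'M[R]_3 := vec_mx (row i X).

Definition xax (X : config) i : 'cV[R]_3 := col 0 (att X i).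
Definition yax (X : config) i : 'cV[R]_3 := col 1 (att X i).
Definition zax (X : config) i : 'cV[R]_3 := col 2 (att X i).

Definition SO3N : set config := [set X | forall i, SO3 (att X i)].

Variable e : rel 'I_N.

Definition consensus : set config :=
  [set X | SO3N X /\ forall i j, e i j -> att X i = att X j].

(* State space of the great-circle system. *)
Definition aligned : set config :=
  [set X | SO3N X /\ forall i j, e i j -> xax X i = xax X j].

(* The information available to agent i: the rows outside the neighborhood of i
   are masked, so a function of relinfo X i depends on R_i^T R_k for the
   neighbors k of i only. *)
Definition relinfo (X : config) (i : 'I_N) : config :=
  tuple_mx (fun k => if e i k then (att X i)^T *m att X k else 0).

Definition relinfo_dom (i : 'I_N) : set config :=
  [set Y | forall k, if e i k then SO3 (att Y k) else att Y k = 0].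

Variables (f : 'I_N -> 'I_N -> R -> R) (g : 'I_N -> 'I_N -> config -> R).

Definition gsum (X : config) i : R := \sum_(j | e i j) g i j (relinfo X i).

Definition control (X : config) i : 'cV[R]_3 :=
  \sum_(j | e i j) f i j (1 - dot (xax X i) (xax X j)) *: xax X j.

Definition closed_loop (X : config) : config :=
  tuple_mx (fun i =>
    spin (cross (xax X i) (control X i) + gsum X i *: xax X i) *m att X i).

(* The columns are the velocities of x_i, y_i and z_i. *)
Definition great_circle (X : config) : config :=
  tuple_mx (fun i => \matrix_(k, l)
    [:: 0; gsum X i * zax X i k 0; - (gsum X i * yax X i k 0)]`_l).

(* For Q in SO3, theta |-> circle_config Q theta is a parametrization by N
   angles of the configurations with x_i = Q e_1 for all i. *)
Definition circle_config (Q : 'M[R]_3) (theta : 'rV[R]_N) : config :=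
  tuple_mx (fun i => Q *m rot1 (theta 0 i)).

(* Almost global consensus in the usual sense: the consensus set is
   asymptotically stable and attracts almost all initial configurations.  The
   second property alone does not imply the first one on a circle: with N = 2,
   the angle phi between y_1 and y_2 may satisfy phi' = 1 - cos phi.
   Almost all refers to the Lebesgue measure of the angles on each great circle;
   since the system is invariant under left multiplication by SO3, the frame Q
   plays no role. *)
Definition great_circle_almost_global_consensus :=
  asymptotically_stable aligned great_circle consensus /\
  forall Q, SO3 Q ->
    null_set [set theta : 'rV[R]_N |
      ~ forall X, trajectory aligned great_circle X ->
          X 0 = circle_config Q theta -> converges_to consensus X].

End Attitudes.

Arguments SO3N R N : clear implicits.

(* Main.v *)
From HB Require Import structures.
Require Import Defs.
From mathcomp Require Import ring lra.
Local Open Scope classical_set_scope.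
Local Open Scope ring_scope.

(** Let x_i = R_i e_1.  The velocity of x_i under the closed loop is the
    projection of u_i on the tangent plane of the sphere at x_i, so the x_i
    follow an autonomous gradient-like consensus flow on the sphere whatever the
    gains g_ij are; on configurations with x_i = x_j for all edges, u_i is
    parallel to x_i and the closed loop is the great-circle system.  The proof
    treats the two levels of this cascade separately.

    Instability at an equilibrium with aligned axes is inherited: both fields
    agree on the invariant set of aligned configurations, hence so do their
    linearizations on its tangent vectors
    [exponentially_unstable_transfer].

    Instability at an equilibrium with misaligned axes comes from the x_i alone.
    There the linearized sphere flow is represented on tangent vectors by a
    symmetric bilinear form [linearized_formC].  Testing it on the projections
    of a common translation w of all x_i and summing over an orthonormal basis
    of vectors w gives exactly
    the sum over ordered edges of s^2 f(s) - (2 - s) s^2 f'(s), which is positive by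
    the condition on the gains [linearized_form_trace].  Maximizing the
    Rayleigh quotient yields an eigenvalue mu > 0 of the sphere flow with an
    eigenvector b [linearized_form_eigenvector].  Since the sphere flow is only
    a quotient of the full linearization A, b gives a left eigenvector of A on
    the tangent space of SO(3)^N; finite dimension turns it into a right
    eigenvector for the same mu [left_to_right_eigenvector].

    Stability of consensus follows from two facts.  First, with c the common axis of a
    nearby consensus configuration, the height V = sum of <x_i, c> is a
    Lyapunov function: half the sum over ordered edges of
    f (<x_i, c> + <x_j, c>) (1 - <x_i, x_j>) is its derivative
    [height_derivative], which is nonnegative where
    V > N - 1, with equality only for aligned axes.  So the aligned set is
    stable and attractive near consensus, although possibly not exponentially
    since f may vanish at 0.  Second, consensus is asymptotically stable inside
    the aligned set by hypothesis.  These combine by a reduction principle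
    [asymptotic_stability_reduction], proved by compactness: a violating
    sequence of trajectories has a limit along an ultrafilter, which is a
    trajectory of the great-circle system contradicting the second fact
    [trajectory_limit]. *)

(** * Differentiation and limits of matrix-valued curves *)

Lemma mx_entry_le (R : realType) m n (A : 'M[R]_(m, n)) i j : `|A i j| <= `|A|.
Proof.
rewrite [leRHS]/Num.Def.normr/= mx_normrE.
exact: (le_bigmax _ (fun ij : 'I_m * 'I_n => `|A ij.1 ij.2|) (i, j)).
Qed.

Lemma mx_norm_le (R : realType) m n (A : 'M[R]_(m, n)) c :
  0 <= c -> (forall i j, `|A i j| <= c) -> `|A| <= c.
Proof.
move=> c0 Ac; rewrite [leLHS]/Num.Def.normr/= mx_normrE.
by apply/bigmax_leP; split.
Qed.

Lemma is_derive_mxE (R : realType) m n (X : R -> 'M[R]_(m, n)) t V i j :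
  is_derive t (1 : R) X V -> is_derive t (1 : R) (fun s => X s i j) (V i j).
Proof.
move=> [Xt XV]; split; first exact: (derivable_mxP _ _ _).1 Xt i j.
by rewrite -XV (derive_mx Xt) mxE.
Qed.

Lemma is_derive_mxP (R : realType) m n (X : R -> 'M[R]_(m, n)) t (V : 'M[R]_(m, n)) :
  (forall i j, is_derive t (1 : R) (fun s => X s i j) (V i j)) ->
  is_derive t (1 : R) X V.
Proof.
move=> XV; have Xt : derivable X t 1.
  by apply/derivable_mxP => i j; case: (XV i j).
split=> //; rewrite (derive_mx Xt); apply/matrixP => i j; rewrite mxE.
by case: (XV i j).
Qed.

Lemma continuous_mxE (R : realType) (T : topologicalType) m n
    (D : set T) (X : T -> 'M[R]_(m, n)) i j :
  {within D, continuous X} -> {within D, continuous (fun s => X s i j)}.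
Proof.
move=> Xc x; apply: (@continuous_comp _ _ _ (X : subspace D -> _) (fun A : 'M[R]_(m, n) => A i j)).
  exact: Xc.
exact: coord_continuous.
Qed.

(** Subtracting the constant velocity k makes one lemma serve twice: k = 0
    bounds the speed of trajectories, and k the velocity at an end point gives
    their uniform differentiability. *)
Lemma mean_value_mx (R : realType) m n (X D : R -> 'M[R]_(m, n)) k a b c :
  a <= b -> 0 <= c -> {within `[a, b], continuous X} ->
  (forall t, t \in `]a, b[ -> is_derive t (1 : R) X (D t)) ->
  (forall t, t \in `[a, b] -> `|D t - k| <= c) ->
  `|X b - X a - (b - a) *: k| <= c * (b - a).
Proof.
move=> ab c0 Xc XD Dk; have ba0 : 0 <= b - a by rewrite subr_ge0.
apply: mx_norm_le => [|i j]; first exact: mulr_ge0.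
have [x xab e] := MVT_segment (df := fun t => D t i j) ab
  (fun t h => is_derive_mxE i j (XD t h)) (@continuous_mxE _ _ _ _ _ _ i j Xc).
rewrite !mxE e mulrC -mulrBr normrM (ger0_norm ba0) mulrC ler_wpM2r//.
by have := le_trans (mx_entry_le (D x - k) i j) (Dk x xab); rewrite !mxE.
Qed.

Lemma is_derive_quotientP (R : realType) (E : normedModType R) (X : R -> E) (t : R) (v : E) :
  is_derive t (1 : R) X v <->
  (fun h : R => h^-1 *: (X (t + h) - X t)) @ 0^' --> v.
Proof.
have eqX : (fun h : R => h^-1 *: ((X \o shift t) (h *: (1 : R)) - X t)) =
    (fun h : R => h^-1 *: (X (t + h) - X t)).
  by apply/funext => h /=; rewrite [h *: 1]mulr1 (addrC h).
split=> [[/cvg_ex[/= l Xl] Xv]|Xv].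
  by rewrite -eqX -Xv; have -> : 'D_1 X t = l by apply/cvg_lim.
by split; rewrite ?/derivable ?/derive eqX; [apply/cvg_ex; exists v|exact/cvg_lim].
Qed.

(** This form of differentiability is stable under pointwise limits as soon as
    eta does not depend on the curve. *)
Lemma is_deriveP (R : realType) (E : normedModType R) (X : R -> E) (t : R) (v : E) :
  is_derive t (1 : R) X v <->
  forall eps : R, 0 < eps -> exists2 eta : R, 0 < eta & forall h : R, `|h| < eta ->
     `|X (t + h) - X t - h *: v| <= eps * `|h|.
Proof.
have quot (h : R) : h != 0 -> `|v - h^-1 *: (X (t + h) - X t)| =
    `|h|^-1 * `|X (t + h) - X t - h *: v|.
  move=> h0; have {1}-> : v = h^-1 *: (h *: v) by rewrite scalerA mulVf // scale1r.
  by rewrite -scalerBr normrZ normfV distrC.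
apply: (iff_trans (is_derive_quotientP X t v)); split=> [/cvgrPdist_le H e e0|H].
  have [/= d d0 Hd] := H e e0; exists d => // h hd.
  have [->|h0] := eqVneq h 0.
    by rewrite addr0 subrr scale0r subr0 !normr0 mulr0.
  have := Hd h; rewrite /= sub0r normrN => /(_ hd h0).
  by rewrite quot // ler_pdivrMl ?normr_gt0// mulrC.
apply/cvgrPdist_le => e e0; have [d d0 Hd] := H e e0.
near=> h; have h0 : h != 0 by near: h; exact: nbhs_dnbhs_neq.
rewrite quot // ler_pdivrMl ?normr_gt0// mulrC; apply: Hd.
by near: h; exact: dnbhs0_lt.
Unshelve. all: by end_near. Qed.

Lemma is_derive_unique (R : realType) (E : normedModType R) (X : R -> E) t v w :
  is_derive t (1 : R) X v -> is_derive t (1 : R) X w -> v = w.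
Proof. by move=> [_ <-] [_ <-]. Qed.

(** Only values on M are compared, as the vector fields are meaningful on the
    state space alone. *)
Lemma compact_uniform_continuity (R : realType) (E E' : normedModType R)
    (M : set E) (F : E -> E') :
  compact M -> {within M, continuous F} ->
  forall eps : R, 0 < eps -> exists2 eta : R, 0 < eta & forall p q, M p -> M q ->
    `|p - q| < eta -> `|F p - F q| < eps.
Proof.
move=> /compact_near_coveringP/near_covering_withinP Mc /subspace_continuousP Fc e e0.
have e20 : 0 < e / 2 by rewrite divr_gt0.
have := Mc R (0^'+) (fun d q => forall p, M p -> `|p - q| < d -> `|F p - F q| < e) _.
case=> [x Mx|d /= d0 Hd].
  have /cvgrPdist_lt/(_ _ e20)/nbhs_ballP[r /= r0 Hr] := Fc x Mx.
  rewrite /at_right; near=> q d => Mq p Mp pq.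
  have qr : `|x - q| < r / 2.
    near: q; apply/nbhs_ballP; exists (r / 2) => /=; first by rewrite divr_gt0.
    by move=> y; rewrite -ball_normE.
  have dr : d < r / 2.
    by near: d; apply: nbhs_right_lt; rewrite divr_gt0.
  have xq : `|F x - F q| < e / 2.
    apply: Hr => //; rewrite -ball_normE /=; apply: lt_trans qr _.
    by rewrite ltr_pdivrMr// ltr_pMr// ltr1n.
  have xp : `|F x - F p| < e / 2.
    apply: Hr => //; rewrite -ball_normE /= (splitr r).
    rewrite -(subrKA q) (le_lt_trans (ler_normD _ _))// ltrD// distrC.
    exact: lt_trans pq dr.
  rewrite -(subrKA (F x)) (le_lt_trans (ler_normD _ _))// (splitr e) ltrD//.
  by rewrite distrC.
exists (d / 2); first by rewrite divr_gt0.
move=> p q Mp Mq pq; apply: (Hd (d / 2)) => //=; last by rewrite divr_gt0.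
rewrite sub0r normrN gtr0_norm ?divr_gt0//.
by rewrite ltr_pdivrMr// ltr_pMr// ltr1n.
Unshelve. all: by end_near. Qed.

Lemma cvg_le_near (R : realType) (U : set_system nat) {UF : ProperFilter U}
    (u : nat -> R) (l c : R) :
  u @ U --> l -> U [set k | u k <= c] -> l <= c.
Proof.
by move=> ul uc; exact: (@closed_cvg _ _ U UF u (fun z => z <= c) (@closed_le R c) uc l ul).
Qed.

Lemma cvg_ge_near (R : realType) (U : set_system nat) {UF : ProperFilter U}
    (u : nat -> R) (l c : R) :
  u @ U --> l -> U [set k | c <= u k] -> c <= l.
Proof.
by move=> ul uc; exact: (@closed_cvg _ _ U UF u (fun z => c <= z) (@closed_ge R c) uc l ul).
Qed.

Lemma ultra_fmap (T T' : Type) (h : T -> T') (U : set_system T) :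
  UltraFilter U -> UltraFilter (h @ U).
Proof.
move=> UU; split=> [|G GP UG]; first exact: fmap_proper_filter.
rewrite predeqE => A; split=> [GA|/UG //].
have [//|UAC] := in_ultra_setVsetC (h @^-1` A) UU.
have /(filterI GA) : G (~` A) by apply: UG.
by rewrite setICr => /filter_not_empty.
Qed.

(** Limits along such an ultrafilter exist in every compact set, for all times
    at once, so no diagonal extraction of subsequences is needed. *)
Lemma free_ultrafilter : exists2 U : set_system nat, UltraFilter U &
  forall P : set nat, (\forall k \near \oo, P k) -> U P.
Proof. by have [U [UU UP]] := ultraFilterLemma eventually_filter; exists U. Qed.

Lemma lipschitz_half_line (R : realType) (V : normedModType R) (h : R -> V) L : 0 < L ->
  (forall s t : R, 0 <= s -> 0 <= t -> `|h t - h s| <= L * `|t - s|) ->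
  {within [set t | 0 <= t], continuous h}.
Proof.
move=> L0 HL; apply/subspace_continuousP => t /= t0; apply/cvgrPdist_le => e e0.
suff : nbhs t (fun s => 0 <= s -> `|h t - h s| <= e) by [].
apply/nbhs_ballP; exists (e / L) => /=; first by rewrite divr_gt0.
move=> s; rewrite -ball_normE /= => ts s0.
apply: le_trans (HL _ _ s0 t0) _.
by rewrite mulrC -ler_pdivlMr // ltW.
Qed.

(** * Limits of trajectories *)

Lemma trajectory_shift (R : realType) (E : normedModType R) (M : set E) F X (s : R) :
  0 <= s -> trajectory M F X -> trajectory M F (fun t => X (s + t)).
Proof.
move=> s0 [Xc XM XF]; split=> [|t t0|t t0]; last 2 first.
- by apply: XM; rewrite addr_ge0.
- have st : 0 < s + t by rewrite ltr_wpDl.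
  have /is_deriveP H := XF _ st; apply/is_deriveP => e e0.
  by have [d d0 Hd] := H e e0; exists d => // h /Hd; rewrite addrA.
move/subspace_continuousP : Xc => Xc; apply/subspace_continuousP => t /= t0.
have st : 0 <= s + t by rewrite addr_ge0.
move=> W WX; have H : nbhs (s + t) (fun u => 0 <= u -> W (X u)) := Xc _ st _ WX.
have sc : (fun u : R => s + u) @ t --> s + t.
  by apply: cvgD; [exact: cvg_cst|exact: cvg_id].
suff : nbhs t (fun u => 0 <= u -> W (X (s + u))) by [].
have /= := sc _ H; apply: (@filterS _ (nbhs t)) => u /= Hu u0; apply: Hu.
by rewrite addr_ge0.
Qed.

Section TrajectoryLimits.
Context (R : realType) (m n : nat).
Let E : normedModType R := 'M[R]_(m, n).
Context (M : set E) (F : E -> E).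
Hypotheses (Mc : compact M) (Fc : {within M, continuous F}).

Lemma trajectory_mean_value X (k : E) (s t c : R) : trajectory M F X ->
  0 <= s -> s <= t -> 0 <= c ->
  (forall u, s <= u -> u <= t -> `|F (X u) - k| <= c) ->
  `|X t - X s - (t - s) *: k| <= c * (t - s).
Proof.
move=> [Xc XM XF] s0 st c0 H.
apply: (@mean_value_mx _ _ _ X (fun t => F (X t))) => //.
- apply: continuous_subspaceW Xc => u /=; rewrite in_itv /= => /andP[su _].
  exact: le_trans su.
- move=> u; rewrite in_itv /= => /andP[su _]; apply: XF.
  exact: le_lt_trans su.
- by move=> u; rewrite in_itv /= => /andP[su ut]; apply: H.
Qed.

Lemma trajectory_lipschitz : exists2 L : R, 0 < L &
  forall X, trajectory M F X -> forall s t, 0 <= s -> 0 <= t ->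
  `|X t - X s| <= L * `|t - s|.
Proof.
have [L [_ HL]] := compact_bounded (continuous_compact Fc Mc).
have FL x : M x -> `|F x| <= Num.max (L + 1) 1.
  move=> Mx; apply: (@le_trans _ _ (L + 1)); last by rewrite le_max lexx.
  by apply: HL => //=; [rewrite ltrDl|exists x].
exists (Num.max (L + 1) 1) => [|X Xt]; first by rewrite lt_max ltr01 orbT.
have H s t : 0 <= s -> s <= t -> `|X t - X s| <= Num.max (L + 1) 1 * (t - s).
  move=> s0 st.
  have := @trajectory_mean_value X 0 s t (Num.max (L + 1) 1) Xt s0 st.
  rewrite scaler0 subr0; apply; first by rewrite le_max ler01 orbT.
  move=> u su _; rewrite subr0; apply: FL; case: Xt => _ + _; apply.
  exact: le_trans su.
move=> s t s0 t0; have [st|ts] := leP s t.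
  by rewrite (@ger0_norm _ (t - s)) ?subr_ge0 //; exact: H.
rewrite distrC (distrC t s) (@gtr0_norm _ (s - t)) ?subr_gt0 //.
by apply: H => //; exact: ltW.
Qed.

(** The modulus eta is common to all trajectories, so that the estimate passes
    to pointwise limits and identifies the derivative of the limit; this replaces
    an integral equation and locally uniform convergence. *)
Lemma trajectory_uniformly_differentiable : forall eps : R, 0 < eps ->
  exists2 eta : R, 0 < eta & forall X, trajectory M F X ->
  forall s t, 0 <= s -> 0 <= t -> `|s - t| < eta ->
  `|X s - X t - (s - t) *: F (X t)| <= eps * `|s - t|.
Proof.
move=> e e0; have [d d0 Hd] := compact_uniform_continuity Mc Fc e0.
have [L L0 HL] := trajectory_lipschitz.
exists (d / L); first by rewrite divr_gt0.
move=> X Xt s t s0 t0 std.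
have close u : 0 <= u -> `|u - t| <= `|s - t| -> `|F (X u) - F (X t)| <= e.
  move=> u0 uts; have [_ XM _] := Xt; apply/ltW/Hd; try exact: XM.
  apply: le_lt_trans (HL _ Xt _ _ t0 u0) _.
  by rewrite mulrC -ltr_pdivlMr //; exact: le_lt_trans std.
have [st|ts] := leP t s.
  rewrite (@ger0_norm _ (s - t)) ?subr_ge0 //.
  apply: trajectory_mean_value => //; first exact: ltW.
  move=> u tu us; apply: close; first exact: le_trans tu.
  by rewrite !ger0_norm ?subr_ge0 // lerD2r.
rewrite -normrN !opprB (_ : _ + _ = X t - X s - (t - s) *: F (X t)); last first.
  rewrite scalerBl scalerBl !opprB addrC addrA [_ - X s]addrC -!addrA.
  by congr (_ + _); rewrite addrCA.
rewrite (distrC s) (@gtr0_norm _ (t - s)) ?subr_gt0 //.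
apply: trajectory_mean_value => //; try exact: ltW.
move=> u su ut; apply: close; first exact: le_trans su.
rewrite distrC (distrC s) ger0_norm ?subr_ge0 // gtr0_norm ?subr_gt0 //.
by rewrite lerD2l lerN2.
Qed.

Lemma cvg_along (U : set_system nat) {UF : Filter U} (T : topologicalType)
    (H : E -> T) (x : nat -> E) (y : E) :
  {within M, continuous H} -> (forall k, M (x k)) -> M y ->
  x k @[k --> U] --> y -> H (x k) @[k --> U] --> H y.
Proof.
move=> /subspace_continuousP Hc xM yM xy W /(Hc _ yM) HW.
have /xy : nbhs y (fun q => M q -> W (H q)) by [].
by apply: (@filterS _ U) => k /=; apply; exact: xM.
Qed.

(** Limits exist pointwise by compactness of M; the uniform estimates above
    survive in the limit and make it differentiable with the right velocity. *)
Lemma trajectory_limit (U : set_system nat) {UU : UltraFilter U}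
    (X : nat -> R -> E) : (forall k, trajectory M F (X k)) ->
  exists2 Y, trajectory M F Y &
    forall t, 0 <= t -> X k t @[k --> U] --> Y t.
Proof.
move=> Xt.
have /choice[Y HY] : forall t : R, exists y, 0 <= t ->
    M y /\ X k t @[k --> U] --> y.
  move=> t; have [t0|/negP t0] := boolP (0 <= t); last by exists 0.
  have := Mc; rewrite compact_ultra => /(_ (X k t @[k --> U])).
  case; first exact: ultra_fmap.
    by apply: (@filterE _ U) => k; have [_ + _] := Xt k; apply.
  by move=> y [My Xy]; exists y.
have YM t : 0 <= t -> M (Y t) by move=> /HY[].
have YX t : 0 <= t -> X k t @[k --> U] --> Y t by move=> /HY[].
have Ydiff : forall eps : R, 0 < eps ->
    exists2 eta : R, 0 < eta & forall s t, 0 <= s -> 0 <= t -> `|s - t| < eta ->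
    `|Y s - Y t - (s - t) *: F (Y t)| <= eps * `|s - t|.
  move=> e e0; have [d d0 Hd] := trajectory_uniformly_differentiable e0.
  exists d => // s t s0 t0 std.
  apply: (@cvg_le_near R U _ (fun k => `|X k s - X k t - (s - t) *: F (X k t)|)); last first.
    by apply: (@filterE _ U) => k; exact: Hd.
  apply: cvg_norm; apply: cvgB; first by apply: cvgB; exact: YX.
  apply: cvgZr; apply: cvg_along => //; first by move=> k; case: (Xt k) => _ + _; apply.
    exact: YM.
  exact: YX.
have Ylip : exists2 L : R, 0 < L & forall s t, 0 <= s -> 0 <= t ->
    `|Y t - Y s| <= L * `|t - s|.
  have [L L0 HL] := trajectory_lipschitz; exists L => // s t s0 t0.
  apply: (@cvg_le_near R U _ (fun k => `|X k t - X k s|)); last first.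
    by apply: (@filterE _ U) => k; exact: HL.
  by apply: cvg_norm; apply: cvgB; exact: YX.
exists Y => //; split=> // [|t t0].
  by have [L L0 HL] := Ylip; exact: lipschitz_half_line L0 HL.
apply/is_deriveP => e e0; have [d d0 Hd] := Ydiff e e0.
exists (Num.min d t); first by rewrite lt_min d0.
move=> h; rewrite lt_min => /andP[hd ht].
have th0 : 0 <= t + h by move: ht; rewrite ltr_norml => /andP[]; lra.
have := Hd (t + h) t th0 (ltW t0); rewrite [t + h - t]addrC addKr.
exact.
Qed.

End TrajectoryLimits.

Section SetDistance.
Context (R : realType) (E : normedModType R) (C : set E).
Hypothesis C0 : C !=set0.

Definition set_dist (x : E) : R := inf [set `|y - x| | y in C].

Let dists x : set R := [set `|y - x| | y in C].

Let dists_inf x : has_inf (dists x).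
Proof.
split; first by have [y Cy] := C0; exists `|y - x|, y.
by exists 0 => _ [y _ <-].
Qed.

(** Turns tubes into sublevel sets of a continuous function, for which limits
    and last times make sense. *)
Lemma tube_distP (r : R) x : tube C r x <-> set_dist x < r.
Proof.
split=> [[y Cy]|xr].
  rewrite -ball_normE /=; apply: le_lt_trans.
  by apply: ge_inf; [case: (dists_inf x)|exists y].
have /(inf_adherent)/(_ (dists_inf x)) : 0 < r - set_dist x by rewrite subr_gt0.
move=> [_ [y Cy <-]]; rewrite -[inf _]/(set_dist x) addrCA subrr addr0 => yr.
by exists y => //; rewrite -ball_normE.
Qed.

Lemma set_dist_lipschitz x y : `|set_dist x - set_dist y| <= `|x - y|.
Proof.
have H u v : set_dist u <= set_dist v + `|u - v|.
  rewrite -lerBlDr; apply: lb_le_inf; first by case: (dists_inf v).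
  move=> _ [z Cz <-]; rewrite lerBlDr.
  apply: (@le_trans _ _ `|z - u|).
    by apply: ge_inf; [case: (dists_inf u)|exists z].
  by rewrite (distrC u) -(subrKA v z) ler_normD.
rewrite ler_norml; have := H x y; have := H y x.
by rewrite (distrC y); lra.
Qed.

Lemma set_dist_continuous : continuous set_dist.
Proof.
move=> x; apply/cvgrPdist_le => e e0; apply/nbhs_ballP; exists e => //= y.
rewrite -ball_normE /= => xy.
exact: le_trans (set_dist_lipschitz x y) (ltW xy).
Qed.

End SetDistance.

(** Restarting a badly behaved trajectory at the last time it is close to the
    target set keeps it away from that set ever after. *)
Lemma last_time_below (R : realType) (h : R -> R) (L T c : R) :
  0 < L -> 0 <= T -> h 0 <= c ->
  (forall s t, 0 <= s -> 0 <= t -> `|h t - h s| <= L * `|t - s|) ->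
  exists s, [/\ 0 <= s, s <= T, h s <= c & forall u, s < u -> u <= T -> c < h u].
Proof.
move=> L0 T0 h0 hL; pose S := [set u | [/\ 0 <= u, u <= T & h u <= c]].
have Ssup : has_sup S by split; [exists 0|exists T => u []].
have sup0 : 0 <= sup S by apply: ub_le_sup; [case: Ssup|].
exists (sup S); split => //.
- by apply: ge_sup; [case: Ssup|move=> u []].
- rewrite leNgt; apply/negP => ch.
  have d0 : 0 < (h (sup S) - c) / L by rewrite divr_gt0 // subr_gt0.
  have [u [u0 uT uc] du] := sup_adherent d0 Ssup.
  have us : u <= sup S by apply: ub_le_sup; [case: Ssup|].
  have := hL u (sup S) u0 sup0.
  rewrite (@ger0_norm _ (sup S - u)) ?subr_ge0 //.
  have : L * (sup S - u) < h (sup S) - c by rewrite mulrC -ltr_pdivlMr //; lra.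
  by have := ler_norm (h (sup S) - h u); lra.
- move=> u su uT; rewrite ltNge; apply/negP => uc.
  suff : u <= sup S by rewrite leNgt su.
  apply: ub_le_sup; first by case: Ssup.
  by split=> //; exact: le_trans (ltW su).
Qed.

(** * Invariance and reduction principles *)

Section Reduction.
Context (R : realType) (m n : nat).
Let E : normedModType R := 'M[R]_(m, n).
Context (M : set E) (F : E -> E) (W : E -> R).
Hypotheses (Mc : compact M) (Fc : {within M, continuous F})
  (Wc : {within M, continuous W}).

Lemma trajectory_subset (A : set E) (G : E -> E) Y :
  (forall x, A x -> F x = G x) -> (forall t, 0 <= t -> A (Y t)) ->
  trajectory M F Y -> trajectory A G Y.
Proof.
move=> FG AY [Yc YM YF]; split=> // t t0.
by rewrite -FG; [exact: YF|apply/AY/ltW].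
Qed.

(** Along translates X (s_k + t) with s_k tending to infinity, V tends to the
    same value for every t, so V is constant along each limit trajectory. *)
Lemma lasalle (V : E -> R) X : {within M, continuous V} -> trajectory M F X ->
  (forall s t, 0 <= s -> s <= t -> V (X s) <= V (X t)) ->
  (forall Y, trajectory M F Y -> V (X 0) <= V (Y 0) ->
     (forall t, 0 <= t -> V (Y t) = V (Y 0)) -> W (Y 0) = 0) ->
  W (X t) @[t --> +oo] --> 0.
Proof.
move=> Vc Xt Vmono limW; apply: contrapT => WX.
have [e e0 He] : exists2 e : R, 0 < e &
    forall T : R, exists2 t : R, T <= t & e < `|W (X t)|.
  apply: contrapT => H; apply: WX; apply/cvgrPdist_le => e e0.
  apply: contrapT => He; apply: H; exists e => // T.
  apply: contrapT => HT; apply: He; exists T; split; first exact: num_real.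
  move=> t Tt; rewrite sub0r normrN leNgt; apply/negP => et.
  by apply: HT; exists t => //; exact: ltW.
have /choice[s Hs] : forall k : nat, exists t : R, k%:R <= t /\ e < `|W (X t)|.
  by move=> k; have [t ? ?] := He k%:R; exists t.
have s0 k : 0 <= s k by apply: le_trans (Hs k).1; exact: ler0n.
have [U UU Uoo] := free_ultrafilter.
have [Y Yt YX] := trajectory_limit Mc Fc
  (fun k => trajectory_shift (s0 k) Xt).
have XM k t : 0 <= t -> M (X (s k + t)).
  by move=> t0; have [_ + _] := Xt; apply; rewrite addr_ge0.
have lim (H : E -> R) t : {within M, continuous H} -> 0 <= t ->
    H (X (s k + t)) @[k --> U] --> H (Y t).
  move=> Hc t0; apply: (@cvg_along _ _ _ M U _ _ H) => //.
  - by move=> k; exact: XM.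
  - by case: Yt => _ + _; apply.
  - exact: YX.
have late u : 0 <= u -> V (X u) <= V (Y 0).
  move=> u0; apply: (cvg_ge_near (lim V 0 Vc (lexx _))).
  apply/Uoo; near=> k; apply: Vmono => //; rewrite addr0.
  by apply: le_trans (Hs k).1; near: k; exact: nbhs_infty_ger.
suff W0 : W (Y 0) = 0.
  have Wlim : `|W (X (s k + 0))| @[k --> U] --> `|W (Y 0)|.
    by apply: cvg_norm; exact: lim.
  have : e <= `|W (Y 0)|.
    apply: (cvg_ge_near Wlim); apply/(@filterE _ U) => k.
    by rewrite /= addr0 ltW //; case: (Hs k).
  by rewrite W0 normr0 leNgt e0.
apply: limW => // [|t t0]; first exact: late.
apply/eqP; rewrite eq_le; apply/andP; split.
  apply: (cvg_le_near (lim V t Vc t0)); apply/(@filterE _ U) => k.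
  by apply: late; rewrite addr_ge0.
have VYt : V (X (s k + t)) - V (X (s k + 0)) @[k --> U] --> V (Y t) - V (Y 0).
  by apply: cvgB; exact: lim.
rewrite -subr_ge0; apply: (cvg_ge_near VYt); apply/(@filterE _ U) => k; rewrite /= subr_ge0 addr0.
by apply: Vmono => //; rewrite lerDl.
Unshelve. all: by end_near. Qed.

(** The Seibert-Florio reduction principle in a compact state space: if C is
    asymptotically stable relative to the zero set A of W, and if A is stable
    and attractive for trajectories that start near C, then C is asymptotically
    stable. *)
Lemma asymptotic_stability_reduction (A C : set E) (G : E -> E) :
  (forall x, A x <-> M x /\ W x = 0) -> (forall x, A x -> F x = G x) ->
  (forall eta : R, 0 < eta -> exists2 delta : R, 0 < delta &
     forall X, trajectory M F X -> tube C delta (X 0) ->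
     forall t, 0 <= t -> `|W (X t)| < eta) ->
  (exists2 delta : R, 0 < delta & forall X, trajectory M F X ->
     tube C delta (X 0) -> W (X t) @[t --> +oo] --> 0) ->
  asymptotically_stable A G C -> asymptotically_stable M F C.
Proof.
move=> AW FG stabW attrW [stabC [d0 d0_gt0 attrC]].
have [C0|CN] := pselect (C !=set0); last first.
  by split=> [e e0|]; exists 1 => // X Xt [y Cy]; case: CN; exists y.
have AY Y : trajectory M F Y -> (forall t, 0 <= t -> W (Y t) = 0) ->
    trajectory A G Y.
  move=> Yt Y0; apply: trajectory_subset (Yt) => // t t0.
  by apply/AW; split; [case: Yt => _ + _; apply|exact: Y0].
have [U UU Uoo] := free_ultrafilter.
have dc (x : nat -> E) y : x k @[k --> U] --> y ->
    set_dist C (x k) @[k --> U] --> set_dist C y.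
  by apply: continuous_cvg; exact: set_dist_continuous.
have Wlim (X : nat -> R -> E) Y t : (forall k, trajectory M F (X k)) ->
    trajectory M F Y -> X k t @[k --> U] --> Y t -> 0 <= t ->
    W (X k t) @[k --> U] --> W (Y t).
  move=> Xt Yt XY t0; apply: (@cvg_along _ _ _ M U _ _ W (fun k => X k t)) => //.
    by move=> k; case: (Xt k) => _ + _; apply.
  by case: Yt => _ + _; apply.
(* A failure of stability gives trajectories X_k that start 1/(k+1)-close to C
   and leave the tube of radius e at times T_k.  Restart X_k at the last time s_k
   at which its distance to C is at most d/2; the limit Y of the restarted
   trajectories stays in A and starts in the tube of radius d. *)
have stab : lyapunov_stable M F C.
  move=> e e0; have [da da_gt0 Hda] := stabC e e0.
  pose d := Num.min da d0.
  have d_gt0 : 0 < d by rewrite lt_min da_gt0.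
  apply: contrapT => unst.
  have /choice[X HX] : forall k : nat, exists X, trajectory M F X /\
      (tube C (Num.min (d / 2) k.+1%:R^-1) (X 0) /\
       exists t : R, 0 <= t /\ ~ tube C e (X t)).
    move=> k; apply: contrapT => NX; apply: unst.
    exists (Num.min (d / 2) k.+1%:R^-1) => [|X Xt X0 t t0].
      by rewrite lt_min divr_gt0 //= invr_gt0 ltr0n.
    by apply: contrapT => Xe; apply: NX; exists X; split=> //; split=> //; exists t.
  have Xt k : trajectory M F (X k) by case: (HX k).
  have X0 k : tube C (Num.min (d / 2) k.+1%:R^-1) (X k 0) by case: (HX k) => _ [].
  have /choice[T HT] : forall k, exists t : R, 0 <= t /\ ~ tube C e (X k t).
    by move=> k; case: (HX k) => _ [].
  have T0 k : 0 <= T k by case: (HT k).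
  have TX k : e <= set_dist C (X k (T k)).
    by rewrite leNgt; apply/negP => /(tube_distP C0); case: (HT k).
  have [L L0 HL] := trajectory_lipschitz Mc Fc.
  have /choice[s Hs] : forall k, exists s, [/\ 0 <= s, s <= T k,
      set_dist C (X k s) <= d / 2 &
      forall u, s < u -> u <= T k -> d / 2 < set_dist C (X k u)].
    move=> k; apply: (@last_time_below _ (fun u => set_dist C (X k u)) L) => //.
      apply/ltW; have /(tube_distP C0) := X0 k.
      by rewrite lt_min => /andP[].
    move=> u v u0 v0; apply: le_trans (set_dist_lipschitz C0 _ _) _.
    exact: (HL _ (Xt k)).
  have s0 k : 0 <= s k by case: (Hs k).
  have Zt k : trajectory M F (fun t => X k (s k + t)) by exact: trajectory_shift.
  have [Y Yt YX] := trajectory_limit Mc Fc Zt.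
  have Yd t : 0 <= t -> set_dist C (X k (s k + t)) @[k --> U] --> set_dist C (Y t).
    by move=> t0; apply: (dc (fun k => X k (s k + t))); exact: YX.
  have YA : trajectory A G Y.
    apply: AY => // t t0; apply/eqP; rewrite -normr_le0; apply/ler_addgt0Pr => eta eta0.
    rewrite add0r.
    have [dW dW0 HW] := stabW eta eta0.
    have WY : `|W (X k (s k + t))| @[k --> U] --> `|W (Y t)|.
      by apply: cvg_norm; apply: (Wlim (fun k t => X k (s k + t))) => //; exact: YX.
    apply: (cvg_le_near WY).
    apply/Uoo; near=> k; apply/ltW/HW; [exact: Xt| |by rewrite addr_ge0].
    apply/(tube_distP C0); have /(tube_distP C0) := X0 k; move/lt_trans; apply.
    rewrite gt_min; apply/orP; right.
    by near: k; exact: near_infty_natSinv_lt (PosNum dW0).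
  have Y0 : tube C d (Y 0).
    apply/(tube_distP C0); apply: (@le_lt_trans _ _ (d / 2)).
      apply: (cvg_le_near (Yd 0 (lexx _))); apply/(@filterE _ U) => k /=.
      by rewrite addr0; case: (Hs k).
    by rewrite ltr_pdivrMr // ltr_pMr // ltr1n.
  have tubeW (r r' : R) x : r <= r' -> tube C r x -> tube C r' x.
    by move=> rr' /(tube_distP C0) xr; apply/(tube_distP C0); exact: lt_le_trans rr'.
  (* If the delays T_k - s_k are bounded, Y reaches distance e in finite time,
     against stability in A; otherwise Y keeps distance d/2, against attraction. *)
  have [[B UB]|Nbdd] := pselect (exists B, U [set k | T k - s k <= B]).
    pose tau k := Num.min (T k - s k) B.
    have tau0 k : 0 <= T k - s k by rewrite subr_ge0; case: (Hs k).
    have B0 : 0 <= B.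
      by have [k] := @filter_ex _ U _ _ UB; exact: le_trans.
    have := @segment_compact R 0 B; rewrite compact_ultra.
    case/(_ (tau k @[k --> U])) => [|/=|tt [ttB taut]]; first exact: ultra_fmap.
      apply: (@filterE _ U) => k /=; rewrite in_itv /= le_min tau0 B0 /=.
      by rewrite ge_min lexx orbT.
    move: ttB; rewrite /= in_itv /= => /andP[tt0 _].
    have [_ +] : True /\ set_dist C (Y tt) < e.
      split=> //; apply/(tube_distP C0); apply: Hda => //.
      by apply: tubeW Y0; rewrite ge_min lexx.
    suff : e <= set_dist C (Y tt) by rewrite leNgt => /negP.
    have lime : set_dist C (X k (s k + tt)) + L * `|tau k - tt| @[k --> U] -->
        set_dist C (Y tt) + L * `|tt - tt|.
      apply: cvgD; first exact: Yd.
      apply: cvgM; first exact: cvg_cst.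
      by apply: cvg_norm; apply: cvgB; [exact: taut|exact: cvg_cst].
    have : e <= set_dist C (Y tt) + L * `|tt - tt|.
      apply: (cvg_ge_near lime); move: UB; apply: (@filterS _ U) => k /= TB.
      have tauE : tau k = T k - s k by rewrite /tau min_l.
      apply: le_trans (TX k) _; rewrite -lerBlDl.
      apply: le_trans (ler_norm _) _.
      apply: le_trans (set_dist_lipschitz C0 _ _) _.
      apply: le_trans (HL _ (Xt k) _ _ _ (T0 k)) _; first by rewrite addr_ge0.
      by rewrite tauE (_ : T k - (s k + tt) = T k - s k - tt) // opprD addrA.
    by rewrite subrr normr0 mulr0 addr0.
  have far t : 0 < t -> d / 2 <= set_dist C (Y t).
    move=> t0; apply: (cvg_ge_near (Yd t (ltW t0))).
    have [UT|UT] := in_ultra_setVsetC [set k | T k - s k <= t] UU.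
      by case: Nbdd; exists t.
    move: UT; apply: (@filterS _ U) => k /= /negP; rewrite -ltNge => tT.
    by apply/ltW; case: (Hs k) => _ _ _; apply; lra.
  have Y0' : tube C d0 (Y 0) by apply: tubeW Y0; rewrite ge_min lexx orbT.
  have d2 : 0 < d / 2 by rewrite divr_gt0.
  have := attrC _ YA Y0' _ d2.
  move=> Yc; have [t [/(tube_distP C0) Yt2 /far]] :=
    @filter_ex _ _ _ _ (filterI Yc (nbhs_pinfty_gt (num_real (0 : R)))).
  by rewrite leNgt Yt2.
split=> //; have [dW dW0 HW] := attrW.
have d02 : 0 < d0 / 2 by rewrite divr_gt0.
have [ds ds0 Hds] := stab _ d02.
exists (Num.min dW ds) => [|X Xt /(tube_distP C0)]; first by rewrite lt_min dW0.
rewrite lt_min => /andP[/(tube_distP C0) XW /(tube_distP C0) Xs] e e0.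
have [de de0 Hde] := stab _ e0.
(* By stability it is enough that X enters the tube of radius de once; if it
   never does, neither does the limit of its translates, against attraction
   in A. *)
have [[T T0 XT]|far] := pselect (exists2 T : R, 0 <= T & tube C de (X T)).
  exists T; split; first exact: num_real.
  move=> t Tt; have -> : t = T + (t - T) by rewrite addrC subrK.
  apply: (Hde (fun t => X (T + t))); first exact: trajectory_shift.
    by rewrite addr0.
  by rewrite subr_ge0 ltW.
have far' t : 0 <= t -> de <= set_dist C (X t).
  by move=> t0; rewrite leNgt; apply/negP => /(tube_distP C0) Xde; apply: far; exists t.
have Zt (k : nat) : trajectory M F (fun t => X (k%:R + t)).
  by apply: trajectory_shift => //; exact: ler0n.
have [Y Yt YX] := trajectory_limit Mc Fc Zt.
have Yd t : 0 <= t -> set_dist C (X (k%:R + t)) @[k --> U] --> set_dist C (Y t).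
  by move=> t0; apply: (dc (fun k => X (k%:R + t))); exact: YX.
have YA : trajectory A G Y.
  apply: AY => // t t0; apply/eqP; rewrite -normr_le0; apply/ler_addgt0Pr => eta eta0.
  rewrite add0r.
  have WY : `|W (X (k%:R + t))| @[k --> U] --> `|W (Y t)|.
    by apply: cvg_norm; apply: (Wlim (fun k t => X (k%:R + t))) => //; exact: YX.
  apply: (cvg_le_near WY); apply/Uoo.
  have /cvgrPdist_le/(_ _ eta0)[T [_ HT]] := HW X Xt XW.
  near=> k; have := HT (k%:R + t); rewrite sub0r normrN; apply.
  by rewrite ltr_wpDr //; near: k; exact: nbhs_infty_gtr.
have Y0 : tube C d0 (Y 0).
  apply/(tube_distP C0); apply: (@le_lt_trans _ _ (d0 / 2)).
    apply: (cvg_le_near (Yd 0 (lexx _))); apply/(@filterE _ U) => k /=.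
    by apply/ltW/(tube_distP C0)/(Hds X Xt Xs); rewrite addr0.
  by rewrite ltr_pdivrMr // ltr_pMr // ltr1n.
have [t [/(tube_distP C0) Yte t0]] :=
  @filter_ex _ _ _ _ (filterI (attrC _ YA Y0 _ de0) (nbhs_pinfty_gt (num_real (0 : R)))).
have : de <= set_dist C (Y t).
  apply: (cvg_ge_near (Yd t (ltW t0))); apply/(@filterE _ U) => k /=.
  by apply: far'; rewrite addr_ge0 // ltW.
by rewrite leNgt Yte.
Unshelve. all: by end_near. Qed.

End Reduction.

(** * Real analytic functions *)

Lemma geometric_sum_le (R : realType) (q : R) n :
  0 <= q -> q <= 2^-1 -> \sum_(i < n) q ^+ i <= 2.
Proof.
move=> q0 q2; have q1 : 0 < 1 - q by lra.
have e : (1 - q) * (\sum_(i < n) q ^+ i) = 1 - q ^+ n.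
  by rewrite -opprB mulNr -subrX1 opprB.
have qn : 0 <= q ^+ n by exact: exprn_ge0.
rewrite -(ler_pM2l q1) e; lra.
Qed.

(** The terms a_k r^k of a convergent series are bounded, so for |h| <= r / 2 the
    tail from degree 2 on is dominated by a geometric series of ratio at most
    1/2. *)
Lemma pseries_remainder (R : realType) (a : nat -> R) (r : R) :
  0 < r -> cvg (pseries a r @ \oo) ->
  exists2 B : R, 0 <= B & forall h l : R, `|h| <= r / 2 ->
    pseries a h @ \oo --> l -> `|l - a 0%N - a 1%N * h| <= B * `|h| ^+ 2.
Proof.
move=> r0 ca.
have [B [_ HB]] := cvg_seq_bounded (cvgP _ (cvg_series_cvg_0 ca)).
have aB k : `|a k * r ^+ k| <= B + 1 by apply: HB => //; rewrite ltrDl.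
have B0 : 0 <= B + 1 := le_trans (normr_ge0 _) (aB 0%N).
have r1 : 0 < r ^+ 2 by exact: exprn_gt0.
exists (2 * (B + 1) / r ^+ 2) => [|h l hr sl].
  by rewrite divr_ge0 ?mulr_ge0 // ltW.
pose q := `|h| / r.
have q0 : 0 <= q by rewrite divr_ge0 // ltW.
have q2 : q <= 2^-1 by rewrite /q ler_pdivrMr // mulrC.
have hq : `|h| = q * r by rewrite /q divfK // gt_eqF.
have term k : `|a k * h ^+ k| <= (B + 1) * q ^+ k.
  rewrite normrM normrX hq exprMn mulrCA mulrC ler_wpM2r ?exprn_ge0 //.
  by apply: le_trans (aB k); rewrite normrM (@ger0_norm _ (r ^+ k)) // exprn_ge0 // ltW.
have part n : `|pseries a h n.+2 - a 0%N - a 1%N * h| <= 2 * (B + 1) / r ^+ 2 * `|h| ^+ 2.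
  rewrite /pseries /series /= big_mkord !big_ord_recl /= /bump /= !expr0 !expr1 mulr1 addrA.
  rewrite (_ : _ - _ - _ = \sum_(i < n) a (i.+2) * h ^+ i.+2); last first.
    by rewrite addn0 (eq_bigr (fun i : 'I_n => a i.+2 * h ^+ i.+2)) //; ring.
  apply: le_trans (ler_norm_sum _ _ _) _.
  apply: (@le_trans _ _ (\sum_(i < n) (B + 1) * q ^+ i.+2)); first by apply: ler_sum => i _.
  have -> : \sum_(i < n) (B + 1) * q ^+ i.+2 = (B + 1) * q ^+ 2 * \sum_(i < n) q ^+ i.
    by rewrite mulr_sumr; apply: eq_bigr => i _; rewrite -mulrA -exprD.
  have -> : 2 * (B + 1) / r ^+ 2 * `|h| ^+ 2 = (B + 1) * q ^+ 2 * 2.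
    by rewrite hq; field; rewrite gt_eqF.
  apply: ler_wpM2l; last exact: geometric_sum_le.
  by rewrite mulr_ge0 // exprn_ge0.
have lim : `|pseries a h n - a 0%N - a 1%N * h| @[n --> \oo] --> `|l - a 0%N - a 1%N * h|.
  apply: cvg_norm; apply: cvgB; last exact: cvg_cst.
  by apply: cvgB; [exact: sl|exact: cvg_cst].
apply: (@closed_cvg _ _ _ _ (fun n => `|pseries a h n - a 0%N - a 1%N * h|)
  (fun z => z <= _) (@closed_le R _) _ _ lim).
near=> n; have n2 : (1 < n)%N by near: n; exact: nbhs_infty_gt.
by rewrite -(subnK n2) addn2; exact: part.
Unshelve. all: by end_near. Qed.

Lemma analytic_derivable (R : realType) (f : R -> R) x :
  real_analytic f -> is_derive x (1 : R) f (derive1 f x).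
Proof.
move=> /(_ x)[a [r [r0 fa]]].
have r20 : 0 < r / 2 by rewrite divr_gt0.
have ca : cvg (pseries a (r / 2) @ \oo).
  by apply: cvgP; apply: fa; rewrite gtr0_norm // ltr_pdivrMr // ltr_pMr // ltr1n.
have [B B0 HB] := pseries_remainder r20 ca.
have rem (h : R) : `|h| <= r / 2 / 2 -> `|f (x + h) - a 0%N - a 1%N * h| <= B * `|h| ^+ 2.
  move=> hr; apply: HB => //; apply: fa; lra.
have fx : f x = a 0%N.
  have := rem 0; rewrite addr0 mulr0 subr0 normr0 expr0n /= mulr0 => H.
  by apply/eqP; rewrite -subr_eq0 -normr_le0; apply: H; lra.
suff fd : is_derive x (1 : R) f (a 1%N) by rewrite derive1E (derive_val (is_derive := fd)).
apply/is_deriveP => e e0; exists (Num.min (r / 2 / 2) (e / (B + 1))).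
  by rewrite lt_min !divr_gt0 //; lra.
move=> h; rewrite lt_min => /andP[hr he].
rewrite fx [h *: _]mulrC; apply: le_trans (rem h (ltW hr)) _.
rewrite expr2 mulrA ler_wpM2r //.
move: he; rewrite ltr_pdivlMr ?ltr_wpDl // => he.
have := normr_ge0 h; lra.
Qed.

(** One-sided agreement suffices: the gains f_ij and f_ji are only assumed to
    agree up to s = 2, where derivatives are still needed. *)
Lemma is_derive_eq_left (R : realType) (f h : R -> R) (x a b d : R) : 0 < d ->
  is_derive x (1 : R) f a -> is_derive x (1 : R) h b ->
  (forall y, x - d < y -> y <= x -> f y = h y) -> a = b.
Proof.
move=> d0 /is_deriveP fa /is_deriveP hb fh; apply/eqP; rewrite -subr_eq0 -normr_le0.
apply/ler_addgt0Pr => e e0; rewrite add0r.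
have e2 : 0 < e / 2 by rewrite divr_gt0.
have [df df0 Hf] := fa _ e2; have [dh dh0 Hh] := hb _ e2.
pose m := Num.min (Num.min df dh) d / 2.
have m0 : 0 < m by rewrite divr_gt0 // !lt_min df0 dh0 d0.
have mm : m < Num.min (Num.min df dh) d.
  by rewrite ltr_pdivrMr // ltr_pMr ?ltr1n // !lt_min df0 dh0 d0.
have : [/\ m < df, m < dh & m < d] by move: mm; rewrite !lt_min -andbA => /and3P[].
move=> [mf mh md].
have nm : `|- m| = m by rewrite normrN gtr0_norm.
have := Hf (- m); rewrite nm => /(_ mf); have := Hh (- m); rewrite nm => /(_ mh).
rewrite (fh (x - m)) ?(fh x) //; [|lra..].
set u := h (x - m) - h x; rewrite /GRing.scale /= => H1 H2.
have : `|m * (a - b)| <= e * m.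
  rewrite (_ : m * (a - b) = (u - - m * a) - (u - - m * b)); last by ring.
  by apply: le_trans (ler_normB _ _) _; lra.
by rewrite normrM (gtr0_norm m0) mulrC ler_pM2r.
Qed.

Lemma is_derive_continuous (R : realType) (f : R -> R) (x a : R) :
  is_derive x (1 : R) f a -> {for x, continuous f}.
Proof. by case=> fx _; exact/differentiable_continuous/derivable1_diffP. Qed.

(** Extends the symmetry of the gains from s > 0 to s = 0. *)
Lemma continuous_eq_right (R : realType) (f h : R -> R) (x d : R) : 0 < d ->
  {for x, continuous f} -> {for x, continuous h} ->
  (forall y, x < y -> y <= x + d -> f y = h y) -> f x = h x.
Proof.
move=> d0 fc hc fh; apply/eqP; rewrite -subr_eq0 -normr_le0.
apply/ler_addgt0Pr => e e0; rewrite add0r.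
have fhc : (fun y => f y - h y) @ x --> f x - h x by apply: cvgB.
move/cvgrPdist_le/(_ e e0)/nbhs_ballP : fhc => [r /= r0 Hr].
pose m := Num.min r d / 2.
have m0 : 0 < m by rewrite divr_gt0 // !lt_min r0 d0.
have : m < Num.min r d by rewrite ltr_pdivrMr // ltr_pMr ?ltr1n // lt_min r0 d0.
rewrite lt_min => /andP[mr md].
have := Hr (x + m); rewrite -ball_normE /= opprD addNKr normrN gtr0_norm // => /(_ mr).
by rewrite (fh (x + m)) ?subrr ?subr0 //; lra.
Qed.

(** * Symmetric bilinear forms on matrices *)

Lemma cvg_mx_entries (R : realType) (T : Type) (U : set_system T) {UF : Filter U}
    m n (X : T -> 'M[R]_(m, n)) (L : 'M[R]_(m, n)) :
  (forall i j, X t i j @[t --> U] --> L i j) -> X t @[t --> U] --> L.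
Proof.
move=> XL; apply/cvgrPdist_le => e e0.
have H : \forall t \near U, forall ij : 'I_m * 'I_n, `|L ij.1 ij.2 - X t ij.1 ij.2| <= e.
  by apply: filter_forall => -[i j]; have /cvgrPdist_le/(_ e e0) := XL i j.
near=> t; apply: mx_norm_le => [|i j]; first exact: ltW.
by rewrite !mxE; exact: (near H t _ (i, j)).
Unshelve. all: by end_near. Qed.

Lemma mx_bounded_closed_compact (R : realType) m n (A : set 'M[R]_(m, n)) (B : R) :
  (forall X, A X -> forall i j, `|X i j| <= B) -> closed A -> compact A.
Proof.
move=> AB Ac; rewrite compact_ultra => U UU UA.
have entry (ij : 'I_m * 'I_n) : exists l : R, (fun X : 'M[R]_(m, n) => X ij.1 ij.2) @ U --> l.
  have := @segment_compact R (- B) B; rewrite compact_ultra.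
  case/(_ ((fun X : 'M[R]_(m, n) => X ij.1 ij.2) @ U)) => [|/=|l [_ Hl]]; first exact: ultra_fmap.
    by apply: (@filterS _ U _ A) => // X /AB/(_ ij.1 ij.2); by rewrite ler_norml /= in_itv.
  by exists l.
have /choice[l Hl] := entry.
have UL : U --> \matrix_(i, j) l (i, j).
  by apply: (@cvg_mx_entries _ _ U _ _ _ id) => i j; rewrite mxE; exact: (Hl (i, j)).
exists (\matrix_(i, j) l (i, j)); split => //.
exact: (@closed_cvg _ _ U _ id A Ac).
Qed.

Definition mxdot (R : realType) m n (v w : 'M[R]_(m, n)) : R :=
  \sum_i \sum_j v i j * w i j.

Section MatrixDot.
Context (R : realType) (m n : nat).
Implicit Types u v w : 'M[R]_(m, n).

Lemma mxdotC v w : mxdot v w = mxdot w v.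
Proof. by do 2![apply: eq_bigr => ? _]; rewrite mulrC. Qed.

Lemma mxdotDl a u v w : mxdot (a *: u + v) w = a * mxdot u w + mxdot v w.
Proof.
rewrite /mxdot mulr_sumr -big_split; apply: eq_bigr => i _ /=.
rewrite mulr_sumr -big_split; apply: eq_bigr => j _ /=.
by rewrite !mxE mulrDl mulrA.
Qed.

Lemma mxdot0l w : mxdot 0 w = 0.
Proof. by rewrite /mxdot big1 // => i _; rewrite big1 // => j _; rewrite mxE mul0r. Qed.

Lemma mxdotZl a v w : mxdot (a *: v) w = a * mxdot v w.
Proof. by rewrite -[a *: v]addr0 mxdotDl mxdot0l addr0. Qed.

Lemma mxdot_ge0 v : 0 <= mxdot v v.
Proof. by apply: sumr_ge0 => i _; apply: sumr_ge0 => j _; rewrite -expr2 sqr_ge0. Qed.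

Lemma mxdot_eq0 v : mxdot v v = 0 -> v = 0.
Proof.
move/eqP; rewrite psumr_eq0; last first.
  by move=> i _; apply: sumr_ge0 => j _; rewrite -expr2 sqr_ge0.
move=> /allP H; apply/matrixP => i j; have := H i (mem_index_enum _).
rewrite psumr_eq0; last by move=> k _; rewrite -expr2 sqr_ge0.
move=> /allP/(_ j (mem_index_enum _)) /=.
by rewrite -expr2 sqrf_eq0 mxE => /eqP.
Qed.

Lemma mxdot_entry_le v i j : v i j ^+ 2 <= mxdot v v.
Proof.
rewrite /mxdot (bigD1 i) //= (bigD1 j) //= -expr2 -addrA lerDl.
by rewrite addr_ge0 // sumr_ge0 // => k _; rewrite ?sumr_ge0 // => *; rewrite -expr2 sqr_ge0.
Qed.

End MatrixDot.

Lemma cvg_sumr (R : realType) (V : normedModType R) (T I : Type)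
    (U : set_system T) {UF : Filter U} (r : seq I) (P : pred I)
    (h : I -> T -> V) (l : I -> V) :
  (forall i, P i -> h i t @[t --> U] --> l i) ->
  \sum_(i <- r | P i) h i t @[t --> U] --> \sum_(i <- r | P i) l i.
Proof. by move=> hl; apply: cvg_big => //; exact: add_continuous. Qed.

Lemma continuous_sum (R : realType) (T : topologicalType) (I : finType)
    (P : pred I) (h : I -> T -> R) :
  (forall i, P i -> continuous (h i)) -> continuous (fun x => \sum_(i | P i) h i x).
Proof. by move=> hc x; apply: cvg_sumr => i Pi; exact: hc. Qed.

Lemma mxdot_continuous (R : realType) m n : continuous (fun v : 'M[R]_(m, n) => mxdot v v).
Proof.
apply: continuous_sum => i _; apply: continuous_sum => j _ v.
by apply: (@continuousM _ _ (fun v : 'M[R]_(m, n) => v i j)); exact: coord_continuous.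
Qed.

Section Rayleigh.
Context (R : realType) (m n : nat).
Context (B : 'M[R]_(m, n) -> 'M[R]_(m, n) -> R).
Hypotheses (BDl : forall a u v w, B (a *: u + v) w = a * B u w + B v w)
  (BC : forall v w, B v w = B w v).

Let BZ a v w : B (a *: v) w = a * B v w.
Proof.
have B0 : B 0 w = 0.
  have := BDl 1 0 0 w; rewrite scaler0 addr0 mul1r => /eqP.
  by rewrite -subr_eq0 opprD addNKr oppr_eq0 => /eqP.
by rewrite -[a *: v]addr0 BDl B0 addr0.
Qed.

Let Bquad u w s : B (u + s *: w) (u + s *: w) =
  B u u + 2 * s * B u w + s ^+ 2 * B w w.
Proof.
rewrite addrC BDl (BC w) (BC u (_ + _)) !BDl (BC w u); ring.
Qed.

Let B_continuous : continuous (fun v => B v v).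
Proof.
have Bexp v w : B v w = \sum_i \sum_j v i j * B (delta_mx i j) w.
  have Bsum (I : finType) (h : I -> 'M[R]_(m, n)) : B (\sum_i h i) w = \sum_i B (h i) w.
    apply: (big_ind2 (fun x y => B x w = y)) => //.
      by rewrite -(scale0r (0 : 'M[R]_(m, n))) BZ mul0r.
    by move=> u1 y1 u2 y2 <- <-; rewrite -[u1]scale1r BDl mul1r scale1r.
  rewrite {1}(matrix_sum_delta v) Bsum; apply: eq_bigr => i _.
  by rewrite Bsum; apply: eq_bigr => j _; rewrite BZ.
have -> : (fun v => B v v) = fun v => \sum_i \sum_j v i j *
    \sum_k \sum_l v k l * B (delta_mx k l) (delta_mx i j).
  apply/funext => v; rewrite Bexp; do 2![apply: eq_bigr => ? _].
  by rewrite BC Bexp.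
apply: continuous_sum => i _; apply: continuous_sum => j _ v.
apply: (@continuousM _ _ (fun v : 'M[R]_(m, n) => v i j)).
  exact: coord_continuous.
move: v; apply: continuous_sum => k _; apply: continuous_sum => l _ v.
apply: (@continuousM _ _ (fun v : 'M[R]_(m, n) => v k l)).
  exact: coord_continuous.
exact: cst_continuous.
Qed.

(** A maximizer b of B v v on the unit sphere satisfies B v v <= mu |v|^2 for
    all v, with equality at b and mu = B b b; the first variation at b in the
    direction w vanishes, which is the eigenvalue equation tested on w. *)
Lemma rayleigh v0 : 0 < B v0 v0 -> exists mu (b : 'M[R]_(m, n)),
  [/\ 0 < mu, b != 0 & forall w, B b w = mu * mxdot b w].
Proof.
move=> Bv0.
have dot0 v : 0 < B v v -> 0 < mxdot v v.
  move=> Bv; rewrite lt_neqAle mxdot_ge0 andbT eq_sym; apply/eqP => /mxdot_eq0 v0E.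
  by move: Bv; rewrite v0E -(scale0r (0 : 'M[R]_(m, n))) BZ mul0r ltxx.
pose S := [set v : 'M[R]_(m, n) | mxdot v v = 1].
have normalize v : 0 < mxdot v v -> S ((Num.sqrt (mxdot v v))^-1 *: v).
  move=> d0; rewrite /S /= mxdotZl mxdotC mxdotZl.
  rewrite mulrA -expr2 exprVn sqr_sqrtr ?mulVf // ?gt_eqF //.
  exact: ltW.
have Sc : compact S.
  apply: (@mx_bounded_closed_compact _ _ _ _ 1).
    move=> v Sv i j; have := mxdot_entry_le v i j; rewrite Sv.
    by rewrite -real_normK ?num_real // -[leRHS](expr1n _ 2) ler_pXn2r // nnegrE.
  apply: (@closed_comp _ _ (fun v => mxdot v v) [set 1]); last exact: closed_eq.
  by move=> v _; exact: mxdot_continuous.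
have S0 : S !=set0 by eexists; apply/normalize/dot0/Bv0.
have [b /[!inE] Sb bmax] :=
  compact_EVT_max S0 Sc (continuous_subspaceT B_continuous).
have form_le v : B v v <= B b b * mxdot v v.
  have := mxdot_ge0 v; rewrite le_eqVlt => /orP[/eqP/esym/mxdot_eq0 ->|d0].
    by rewrite mxdot0l mulr0 -(scale0r (0 : 'M[R]_(m, n))) BZ mul0r.
  have := bmax _ (mem_set (normalize v d0)).
  rewrite BZ BC BZ mulrA -expr2 exprVn sqr_sqrtr; last exact: ltW.
  by rewrite mulrC ler_pdivrMr.
have b_pos : 0 < B b b.
  by have := form_le v0; have := dot0 v0 Bv0; nra.
exists (B b b), b; split=> // [|w].
  by apply/eqP => b0; move: Sb; rewrite b0 /S /= mxdot0l => /eqP; rewrite eq_sym oner_eq0.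
pose c := B b b * mxdot b w - B b w.
pose p := B b b * mxdot w w - B w w.
have key s : 0 <= 2 * s * c + s ^+ 2 * p.
  have := form_le (b + s *: w); rewrite Bquad.
  have -> : mxdot (b + s *: w) (b + s *: w) =
      mxdot b b + 2 * s * mxdot b w + s ^+ 2 * mxdot w w.
    by rewrite addrC mxdotDl (mxdotC w) (mxdotC b (_ + _)) !mxdotDl (mxdotC w b); ring.
  by rewrite Sb /c /p; lra.
suff : c = 0 by rewrite /c => /eqP; rewrite subr_eq0 => /eqP.
(* 2 s c + s^2 p >= 0 for all s forces c = 0; this choice of s makes the left
   side a negative multiple of c^2. *)
have := key (- c / (`|p| + 1)).
have p1 : 0 < `|p| + 1 by rewrite ltr_wpDl.
have -> : 2 * (- c / (`|p| + 1)) * c + (- c / (`|p| + 1)) ^+ 2 * p =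
    (c / (`|p| + 1)) ^+ 2 * (p - 2 * (`|p| + 1)) by field; rewrite gt_eqF.
have p2 : 0 < 2 * (`|p| + 1) - p by have := ler_norm p; have := normr_ge0 p; lra.
move=> H; apply/eqP; move: H; apply: contraTT => c0; rewrite -ltNge.
rewrite pmulr_rlt0; first lra.
by rewrite exprn_even_gt0 //= mulf_neq0 // invr_neq0 // gt_eqF.
Qed.

End Rayleigh.

(** * Vectors and rotations in dimension three *)

Lemma sum3 (V : nmodType) (F : 'I_3 -> V) : \sum_i F i = F 0 + F 1 + F 2.
Proof.
rewrite !big_ord_recl big_ord0 addr0 addrA.
by congr (_ + _ + _); congr F; apply/val_inj.
Qed.

Lemma forall_ord3 (P : 'I_3 -> Prop) : P 0 -> P 1 -> P 2 -> forall i, P i.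
Proof.
move=> P0 P1 P2 [[|[|[|//]]] i].
- by rewrite (_ : Ordinal i = 0) //; apply/val_inj.
- by rewrite (_ : Ordinal i = 1) //; apply/val_inj.
- by rewrite (_ : Ordinal i = 2) //; apply/val_inj.
Qed.

Lemma mx_addE (R : realType) m n (A B : 'M[R]_(m, n)) i j : (A + B) i j = A i j + B i j.
Proof. by rewrite mxE. Qed.

Lemma mx_oppE (R : realType) m n (A : 'M[R]_(m, n)) i j : (- A) i j = - A i j.
Proof. by rewrite mxE. Qed.

Lemma mx_scaleE (R : realType) m n k (A : 'M[R]_(m, n)) i j : (k *: A) i j = k * A i j.
Proof. by rewrite mxE. Qed.

Lemma mx_zeroE (R : realType) m n i j : (0 : 'M[R]_(m, n)) i j = 0.
Proof. by rewrite mxE. Qed.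

Definition mx_coords := (mx_zeroE, mx_addE, mx_oppE, mx_scaleE).

Section Vectors.
Context (R : realType).
Implicit Types (a b c : 'cV[R]_3) (Q : 'M[R]_3).

Lemma dotE a b : dot a b = a 0 0 * b 0 0 + a 1 0 * b 1 0 + a 2 0 * b 2 0.
Proof. by rewrite /dot mxE sum3 !mxE. Qed.

Lemma cv3P a b : a 0 0 = b 0 0 -> a 1 0 = b 1 0 -> a 2 0 = b 2 0 -> a = b.
Proof.
by move=> *; apply/matrixP => i j; rewrite (ord1 j); move: i; exact: forall_ord3.
Qed.

Lemma crossE0 a b : cross a b 0 0 = a 1 0 * b 2 0 - a 2 0 * b 1 0.
Proof. by rewrite /cross mxE sum3 !mxE /=; ring. Qed.

Lemma crossE1 a b : cross a b 1 0 = a 2 0 * b 0 0 - a 0 0 * b 2 0.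
Proof. by rewrite /cross mxE sum3 !mxE /=; ring. Qed.

Lemma crossE2 a b : cross a b 2 0 = a 0 0 * b 1 0 - a 1 0 * b 0 0.
Proof. by rewrite /cross mxE sum3 !mxE /=; ring. Qed.

Definition cross_coords := (crossE0, crossE1, crossE2).

Lemma det3E Q : \det Q = dot (cross (col 0 Q) (col 1 Q)) (col 2 Q).
Proof.
rewrite dotE !cross_coords (expand_det_row _ 0) sum3 /cofactor.
rewrite !(expand_det_row _ 0) /cofactor !big_ord_recl !big_ord0 /= !det_mx11 !mxE /=.
have [q e] : exists q : nat -> nat -> R, forall i j, Q i j = q (val i) (val j).
  by exists (fun i j => Q (inord i) (inord j)) => i j; rewrite !inord_val.
rewrite !e /= /bump /= !(expr0, expr1, addn0, add0n) /=.
ring.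
Qed.

Lemma cross_cross a b c : cross (cross a b) c = dot a c *: b - dot b c *: a.
Proof. by apply: cv3P; rewrite !(mx_coords, cross_coords) !dotE; ring. Qed.

Lemma cross_self a : cross a a = 0.
Proof. by apply: cv3P; rewrite !(mx_coords, cross_coords); ring. Qed.

Lemma crossC a b : cross a b = - cross b a.
Proof. by apply: cv3P; rewrite !(mx_coords, cross_coords); ring. Qed.

Lemma crossDl a b c : cross (a + b) c = cross a c + cross b c.
Proof. by apply: cv3P; rewrite !(mx_coords, cross_coords); ring. Qed.

Lemma crossZl (k : R) a b : cross (k *: a) b = k *: cross a b.
Proof. by apply: cv3P; rewrite !(mx_coords, cross_coords); ring. Qed.

Lemma dotC a b : dot a b = dot b a.
Proof. by rewrite !dotE; ring. Qed.

Lemma dotDl a b c : dot (a + b) c = dot a c + dot b c.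
Proof. by rewrite !dotE !mxE; ring. Qed.

Lemma dotDr a b c : dot c (a + b) = dot c a + dot c b.
Proof. by rewrite !dotE !mxE; ring. Qed.

Lemma dotBl a b c : dot (a - b) c = dot a c - dot b c.
Proof. by rewrite !dotE !mxE; ring. Qed.

Lemma dotBr a b c : dot c (a - b) = dot c a - dot c b.
Proof. by rewrite !dotE !mxE; ring. Qed.

Lemma dotZl (k : R) a b : dot (k *: a) b = k * dot a b.
Proof. by rewrite !dotE !mxE; ring. Qed.

Lemma dotZr (k : R) a b : dot a (k *: b) = k * dot a b.
Proof. by rewrite !dotE !mxE; ring. Qed.

Lemma dot_ge0 a : 0 <= dot a a.
Proof. by rewrite dotE -!expr2 !addr_ge0 // sqr_ge0. Qed.

Lemma dot_eq0 a : dot a a = 0 -> a = 0.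
Proof.
move/eqP; rewrite dotE -!expr2 !paddr_eq0 ?addr_ge0 ?sqr_ge0 // !sqrf_eq0.
by move=> /andP[/andP[/eqP a0 /eqP a1] /eqP a2]; apply: cv3P; rewrite mxE.
Qed.

Lemma dot_le1 a b : dot a a = 1 -> dot b b = 1 -> dot a b <= 1.
Proof.
move=> a1 b1; have := dot_ge0 (a - b).
by rewrite dotBl !dotBr a1 b1 (dotC b a); lra.
Qed.

Lemma dot_geN1 a b : dot a a = 1 -> dot b b = 1 -> -1 <= dot a b.
Proof.
move=> a1 b1; have := dot_ge0 (a + b).
by rewrite dotDl !dotDr a1 b1 (dotC b a); lra.
Qed.

Lemma dot_eq1 a b : dot a a = 1 -> dot b b = 1 -> dot a b = 1 -> a = b.
Proof.
move=> a1 b1 ab; apply/eqP; rewrite -subr_eq0; apply/eqP/dot_eq0.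
by rewrite dotBl !dotBr a1 b1 (dotC b a) ab; lra.
Qed.

Lemma col_mulmx Q Q' l : col l (Q *m Q') = Q *m col l Q'.
Proof. by apply/matrixP => i j; rewrite !mxE; apply: eq_bigr => k _; rewrite !mxE. Qed.

Lemma SO3_dot_col Q i j : SO3 Q -> dot (col i Q) (col j Q) = (i == j)%:R.
Proof.
move=> [QQ _]; have -> : dot (col i Q) (col j Q) = (Q^T *m Q) i j.
  by rewrite dotE [RHS]mxE sum3 !mxE.
by rewrite QQ mxE.
Qed.

(** The unit vectors x cross y and z have inner product det Q = 1, so they are
    equal. *)
Lemma SO3_frame Q : SO3 Q ->
  cross (col 0 Q) (col 1 Q) = col 2 Q /\ cross (col 0 Q) (col 2 Q) = - col 1 Q.
Proof.
move=> SQ; have xy : cross (col 0 Q) (col 1 Q) = col 2 Q.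
  have : dot (cross (col 0 Q) (col 1 Q)) (col 2 Q) = 1 by rewrite -det3E; case: SQ.
  apply: dot_eq1; last by rewrite SO3_dot_col.
  have -> : forall a b, dot (cross a b) (cross a b) =
      dot a a * dot b b - dot a b ^+ 2.
    by move=> a b; rewrite !dotE !cross_coords; ring.
  by rewrite !SO3_dot_col //= expr0n /= mulr1 subr0.
split=> //; rewrite -xy crossC cross_cross !SO3_dot_col //=.
by rewrite scale1r scale0r subr0.
Qed.

Lemma SO3_mulmxV Q : SO3 Q -> Q *m Q^T = 1%:M.
Proof. by case=> + _; exact: mulmx1C. Qed.

Lemma SO3_entry Q i j : SO3 Q -> `|Q i j| <= 1.
Proof.
move=> SQ; have := SO3_dot_col j j SQ; rewrite eqxx dotE !mxE -!expr2 => H.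
have : Q i j ^+ 2 <= 1.
  move: i; apply: forall_ord3; have := sqr_ge0 (Q 0 j);
  have := sqr_ge0 (Q 1 j); have := sqr_ge0 (Q 2 j); move: H; rewrite /=; lra.
by rewrite -real_normK ?num_real // -[leRHS](expr1n _ 2) ler_pXn2r // nnegrE.
Qed.

Definition unspin Q : 'cV[R]_3 := \col_i [:: Q 2 1; Q 0 2; Q 1 0]`_i.

Lemma spinK a : unspin (spin a) = a.
Proof. by apply: cv3P; rewrite !mxE. Qed.

Lemma unspinK Q : Q + Q^T = 0 -> spin (unspin Q) = Q.
Proof.
move=> QQ; have e i j : Q i j = - Q j i.
  apply/eqP; rewrite -subr_eq0 opprK.
  by have := congr1 (fun A : 'M[R]_3 => A i j) QQ; rewrite !mxE => ->.
have d i : Q i i = 0 by have := e i i; lra.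
apply/matrixP; apply: forall_ord3; apply: forall_ord3; rewrite !mxE /= ?d //;
  by rewrite [RHS]e.
Qed.

Lemma spin_tr a : (spin a)^T = - spin a.
Proof.
by apply/matrixP; apply: forall_ord3; apply: forall_ord3; rewrite !mxE /= ?oppr0 ?opprK.
Qed.

Lemma spinD a b : spin (a + b) = spin a + spin b.
Proof.
by apply/matrixP; apply: forall_ord3; apply: forall_ord3; rewrite !mxE /=; ring.
Qed.

Lemma spinZ (k : R) a : spin (k *: a) = k *: spin a.
Proof.
by apply/matrixP; apply: forall_ord3; apply: forall_ord3; rewrite !mxE /=; ring.
Qed.

End Vectors.

(** * The closed loop and its reduction to the sphere *)

Section ConfigAlgebra.
Context (R : realType) (N : nat).
Implicit Types (X : config R N) (i j : 'I_N).

Lemma attE X i k l : att X i k l = X i (mxvec_index k l).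
Proof. by rewrite !mxE. Qed.

Lemma xaxE X i k : xax X i k 0 = X i (mxvec_index k 0).
Proof. by rewrite mxE attE. Qed.

Lemma att_tuple_mx (Q : 'I_N -> 'M[R]_3) i : att (tuple_mx Q) i = Q i.
Proof. by rewrite /att /tuple_mx rowK mxvecK. Qed.

Lemma config_eqP X X' : (forall i, att X i = att X' i) -> X = X'.
Proof.
by move=> XX; apply/row_matrixP => i; apply: (can_inj vec_mxK); exact: XX.
Qed.

Lemma attD (a : R) X X' i : att (a *: X + X') i = a *: att X i + att X' i.
Proof. by rewrite /att !linearP. Qed.

Lemma xaxD (a : R) X X' i : xax (a *: X + X') i = a *: xax X i + xax X' i.
Proof. by rewrite /xax attD linearP. Qed.

Lemma xax_unit X i : SO3N R N X -> dot (xax X i) (xax X i) = 1.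
Proof. by move=> SX; rewrite SO3_dot_col. Qed.

Variables (e : rel 'I_N) (f : 'I_N -> 'I_N -> R -> R).

(** The control as a function of the axes x_i alone; [control e f X] is its value
    at [xax X]. *)
Definition reduced_control (x : 'I_N -> 'cV[R]_3) i : 'cV[R]_3 :=
  \sum_(j | e i j) f i j (1 - dot (x i) (x j)) *: x j.

Definition reduced_field (x : 'I_N -> 'cV[R]_3) i : 'cV[R]_3 :=
  reduced_control x i - dot (x i) (reduced_control x i) *: x i.

Variable g : 'I_N -> 'I_N -> config R N -> R.

(** The term along x_i in the angular velocity does not move x_i, which
    decouples the axes from the gains g_ij. *)
Lemma xax_closed_loop X i : SO3N R N X ->
  xax (closed_loop e f g X) i = reduced_field (xax X) i.
Proof.
move=> SX; rewrite /xax att_tuple_mx col_mulmx -/(cross _ _) -/(xax X i).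
rewrite crossDl crossZl cross_self scaler0 addr0 cross_cross xax_unit // scale1r.
by rewrite dotC.
Qed.

Lemma closed_loop_aligned X : aligned e X ->
  closed_loop e f g X = great_circle e g X.
Proof.
move=> [SX al]; apply: config_eqP => i; rewrite !att_tuple_mx.
have -> : cross (xax X i) (control e f X i) = 0.
  rewrite /control (eq_bigr (fun j => f i j (1 - dot (xax X i) (xax X j)) *: xax X i)).
    by rewrite -scaler_suml crossC crossZl cross_self scaler0 oppr0.
  by move=> j eij; rewrite (al _ _ eij).
rewrite add0r; have [xy xz] := SO3_frame (SX i).
apply/matrixP => k l.
have -> : (spin (gsum e g X i *: xax X i) *m att X i) k l =
    gsum e g X i * cross (xax X i) (col l (att X i)) k 0.
  by rewrite -mx_scaleE -crossZl /cross -col_mulmx [RHS]mxE.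
move: l; apply: forall_ord3; rewrite [RHS]mxE /=.
- by rewrite -/(xax X i) cross_self mxE mulr0.
- by rewrite xy.
- by rewrite xz mxE mulrN.
Qed.

End ConfigAlgebra.

(** * Continuity of the closed loop and compactness of the state space *)

Section Limits.
Context (R : realType) (T : Type) (U : set_system T) {UF : Filter U}.

Lemma cvg_mxE m n (A : T -> 'M[R]_(m, n)) (L : 'M[R]_(m, n)) i j :
  A t @[t --> U] --> L -> A t i j @[t --> U] --> L i j.
Proof.
move=> AL; apply: (@continuous_cvg _ _ _ U _ A (fun B : 'M[R]_(m, n) => B i j)) => //.
exact: coord_continuous.
Qed.

Lemma cvg_mulmx m n p (A : T -> 'M[R]_(m, n)) (B : T -> 'M[R]_(n, p))
    (LA : 'M[R]_(m, n)) (LB : 'M[R]_(n, p)) :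
  A t @[t --> U] --> LA -> B t @[t --> U] --> LB ->
  A t *m B t @[t --> U] --> LA *m LB.
Proof.
move=> AL BL; apply: cvg_mx_entries => i j; rewrite mxE.
rewrite (_ : (fun t => _) = fun t => \sum_k A t i k * B t k j); last first.
  by apply/funext => t; rewrite mxE.
by apply: cvg_sumr => k _; apply: cvgM; exact: cvg_mxE.
Qed.

Lemma cvg_trmx m n (A : T -> 'M[R]_(m, n)) (L : 'M[R]_(m, n)) :
  A t @[t --> U] --> L -> (A t)^T @[t --> U] --> L^T.
Proof.
move=> AL; apply: cvg_mx_entries => i j; rewrite mxE.
rewrite (_ : (fun t => _) = fun t => A t j i); first exact: cvg_mxE.
by apply/funext => t; rewrite mxE.
Qed.

Lemma cvg_spin (a : T -> 'cV[R]_3) (l : 'cV[R]_3) :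
  a t @[t --> U] --> l -> spin (a t) @[t --> U] --> spin l.
Proof.
have spinE (b : 'cV[R]_3) : spin b = \sum_k b k 0 *: spin (delta_mx k 0).
  apply/matrixP; apply: forall_ord3; apply: forall_ord3;
    rewrite summxE sum3 !mxE /=; ring.
move=> al; rewrite spinE; under eq_cvg do rewrite spinE.
by apply: cvg_sumr => k _; apply: cvgZ; [exact: cvg_mxE|exact: cvg_cst].
Qed.

Lemma cvg_dot (a b : T -> 'cV[R]_3) (la lb : 'cV[R]_3) :
  a t @[t --> U] --> la -> b t @[t --> U] --> lb ->
  dot (a t) (b t) @[t --> U] --> dot la lb.
Proof.
move=> al bl; apply: cvg_mxE; apply: cvg_mulmx => //; exact: cvg_trmx.
Qed.

Lemma cvg_scalemx m n (k : T -> R) (A : T -> 'M[R]_(m, n)) (lk : R) (L : 'M[R]_(m, n)) :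
  k t @[t --> U] --> lk -> A t @[t --> U] --> L ->
  k t *: A t @[t --> U] --> lk *: L.
Proof. by move=> ? ?; apply: cvgZ. Qed.

Lemma cvg_col m n (A : T -> 'M[R]_(m, n)) (L : 'M[R]_(m, n)) l :
  A t @[t --> U] --> L -> col l (A t) @[t --> U] --> col l L.
Proof.
move=> AL; apply: cvg_mx_entries => i j; rewrite mxE.
by under eq_cvg do rewrite mxE; exact: cvg_mxE.
Qed.

Context (N : nat).

Lemma cvg_att (Y : T -> config R N) (L : config R N) i :
  Y t @[t --> U] --> L -> att (Y t) i @[t --> U] --> att L i.
Proof.
move=> YL; apply: cvg_mx_entries => k l; rewrite attE.
by under eq_cvg do rewrite attE; exact: cvg_mxE.
Qed.

Lemma cvg_xax (Y : T -> config R N) (L : config R N) i :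
  Y t @[t --> U] --> L -> xax (Y t) i @[t --> U] --> xax L i.
Proof.
by move=> YL; apply: cvg_col; exact: cvg_att.
Qed.

Lemma cvg_tuple_mx (Q : T -> 'I_N -> 'M[R]_3) (L : 'I_N -> 'M[R]_3) :
  (forall i, Q t i @[t --> U] --> L i) ->
  tuple_mx (Q t) @[t --> U] --> tuple_mx L.
Proof.
move=> QL; apply: cvg_mx_entries => i kl; case/mxvec_indexP: kl => k l.
rewrite mxE mxvecE; under eq_cvg do rewrite mxE mxvecE.
exact: cvg_mxE.
Qed.

End Limits.

Lemma closed_SO3N (R : realType) N : closed (SO3N R N).
Proof.
have clos (T : topologicalType) (h : config R N -> T) (c : T) :
    hausdorff_space T -> continuous h -> closed [set X | h X = c].
  move=> hT hc; apply: (@closed_comp _ _ h [set c]) => [X _|]; first exact: hc.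
  exact/accessible_closed_set1/hausdorff_accessible.
have -> : SO3N R N = \bigcap_(i in [set: 'I_N]) ([set X | (att X i)^T *m att X i = 1%:M] `&`
    [set X | dot (cross (col 0 (att X i)) (col 1 (att X i))) (col 2 (att X i)) = 1]).
  apply/seteqP; split=> X /= SX i; first by move=> _ /=; rewrite -det3E; case: (SX i).
  by case: (SX i I) => ? ?; split=> //; rewrite det3E.
apply: closed_bigI => i _; have attc (X : config R N) : att Y i @[Y --> X] --> att X i.
  exact: (@cvg_att R _ (nbhs X) _ N id X i cvg_id).
have colc (X : config R N) l : col l (att Y i) @[Y --> X] --> col l (att X i).
  exact: (@cvg_col R _ (nbhs X) _ _ _ (fun Y : config R N => att Y i) _ l (attc X)).
apply: closedI; apply: clos; try exact: norm_hausdorff.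
  by move=> X; exact: (cvg_mulmx (cvg_trmx (attc X)) (attc X)).
by move=> X; exact: (cvg_dot (cvg_mulmx (cvg_spin (colc X 0)) (colc X 1)) (colc X 2)).
Qed.

Lemma compact_SO3N (R : realType) N : compact (SO3N R N).
Proof.
apply: (@mx_bounded_closed_compact _ _ _ _ 1); last exact: closed_SO3N.
move=> X SX i kl; case/mxvec_indexP: kl => k l.
by rewrite -attE; exact: SO3_entry.
Qed.

Lemma locally_lipschitz_continuous (R : realType) (E E' : normedModType R)
    (h : E -> E') (A : set E) :
  [locally [lipschitz h x | x in A]] -> {within A, continuous h}.
Proof.
move=> hl; apply/subspace_continuousP => x Ax.
have [M [_ HM]] := hl (x, x) (conj Ax Ax).
have M0 : 0 <= Num.max M 0 by rewrite le_max lexx orbT.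
have Mlt : M < Num.max M 0 + 1 by rewrite ltr_pwDr // le_max lexx.
have [[P Q] /= [Px Qx] PQ] := HM _ Mlt.
set K := Num.max M 0 + 1 in Mlt PQ.
have K0 : 0 < K by rewrite ltr_wpDl.
apply/cvgrPdist_le => eps eps0.
have xK : \forall y \near x, `|x - y| <= eps / K.
  apply/nbhs_ballP; exists (eps / K) => /=; first by rewrite divr_gt0.
  by move=> y; rewrite -ball_normE => /ltW.
suff : \forall y \near x, A y -> `|h x - h y| <= eps by [].
near=> y => Ay.
have Py : Q y by near: y.
have xy : `|x - y| <= eps / K by near: y.
have := PQ (x, y) (conj (nbhs_singleton Px) Py) (conj Ax Ay) => /= /le_trans; apply.
by rewrite mulrC -ler_pdivlMr.
Unshelve. all: by end_near. Qed.

Section ClosedLoopContinuity.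
Context (R : realType) (N : nat) (e : rel 'I_N).
Context (f : 'I_N -> 'I_N -> R -> R) (g : 'I_N -> 'I_N -> config R N -> R).

Lemma relinfo_in_dom (e_irr : irreflexive e) X i : SO3N R N X ->
  relinfo_dom e i (relinfo e X i).
Proof.
move=> SX k; rewrite att_tuple_mx; case: ifP => [eik|->] //; rewrite eik.
have [Q1 d1] := SX i; have [Q2 d2] := SX k.
split; last by rewrite det_mulmx det_tr d1 d2 mulr1.
rewrite trmx_mul trmxK mulmxA -(mulmxA (att X k)^T) (SO3_mulmxV (SX i)).
by rewrite mulmx1.
Qed.

Lemma cvg_relinfo (X : config R N) i : relinfo e Y i @[Y --> X] --> relinfo e X i.
Proof.
apply: (@cvg_tuple_mx R _ (nbhs X)) => k.
case: (e i k); last first.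
  move=> W W0; apply: (@filterE _ (nbhs X)) => Y /=.
  exact: (@nbhs_singleton _ (0 : 'M[R]_3) W W0).
have attc j : att Y j @[Y --> X] --> att X j.
  exact: (@cvg_att R _ (nbhs X) _ N id X j cvg_id).
exact: (cvg_mulmx (cvg_trmx (attc i)) (attc k)).
Qed.

Hypotheses (e_irr : irreflexive e)
  (f_cont : forall i j, e i j -> continuous (f i j))
  (g_lip : forall i j, e i j -> [locally [lipschitz g i j Y | Y in relinfo_dom e i]]).

Lemma cvg_gsum (X : config R N) i : SO3N R N X ->
  gsum e g Y i @[Y --> within (SO3N R N) (nbhs X)] --> gsum e g X i.
Proof.
move=> SX; apply: cvg_sumr => j eij.
have /subspace_continuousP gc := locally_lipschitz_continuous (g_lip eij).
move=> W gW; have H := gc _ (relinfo_in_dom e_irr i SX) _ gW.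
have H' : nbhs (relinfo e X i) (fun Z => relinfo_dom e i Z -> W (g i j Z)) := H.
have := cvg_relinfo (X := X) (i := i) H'.
apply: (@filterS _ (nbhs X)) => Y /= HY SY; apply: HY; exact: relinfo_in_dom.
Qed.

Lemma cvg_control (X : config R N) i (U : set_system (config R N)) {UF : Filter U} :
  (Y @[Y --> U] --> X) -> control e f Y i @[Y --> U] --> control e f X i.
Proof.
move=> YX; apply: cvg_sumr => j eij.
have dc := cvgB (cvg_cst (1 : R)) (cvg_dot (cvg_xax (i:=i) YX) (cvg_xax (i:=j) YX)).
have fc : f i j (1 - dot (xax Y i) (xax Y j)) @[Y --> U] -->
    f i j (1 - dot (xax X i) (xax X j)).
  apply: (@continuous_cvg _ _ _ U _ (fun Y => 1 - dot (xax Y i) (xax Y j)) (f i j)).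
    exact: f_cont.
  exact: dc.
exact: (cvg_scalemx fc (cvg_xax (i:=j) YX)).
Qed.

Lemma closed_loop_continuous : {within SO3N R N, continuous (closed_loop e f g)}.
Proof.
apply/subspace_continuousP => X SX.
have YX : Y @[Y --> within (SO3N R N) (nbhs X)] --> X .
  exact: cvg_within.
apply: (@cvg_tuple_mx R _ (within (SO3N R N) (nbhs X))) => i.
have c1 := cvg_mulmx (cvg_spin (cvg_xax (i:=i) YX)) (cvg_control (i:=i) YX).
have c2 := cvg_scalemx (cvg_gsum (i:=i) SX) (cvg_xax (i:=i) YX).
exact: (cvg_mulmx (cvg_spin (cvgD (c1 _ _ _ _) (c2 _ _))) (cvg_att (i:=i) YX)).
Qed.

End ClosedLoopContinuity.

(** * Differentiation rules *)

Section Derivatives.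
Context (R : realType).
Implicit Types (t : R).

Lemma is_derive_sumr (V : normedModType R) (I : finType) (P : pred I)
    (h : I -> R -> V) (d : I -> V) t :
  (forall i, P i -> is_derive t (1 : R) (h i) (d i)) ->
  is_derive t (1 : R) (fun s => \sum_(i | P i) h i s) (\sum_(i | P i) d i).
Proof.
move=> hd; apply/is_derive_quotientP.
rewrite (_ : (fun _ => _) =
    fun s : R => \sum_(i | P i) s^-1 *: (h i (t + s) - h i t)).
  by apply: cvg_sumr => i Pi; apply/is_derive_quotientP; exact: hd.
by apply/funext => s; rewrite -sumrB scaler_sumr.
Qed.

Lemma is_derive_dot (a b : R -> 'cV[R]_3) (a' b' : 'cV[R]_3) t :
  is_derive t (1 : R) a a' -> is_derive t (1 : R) b b' ->
  is_derive t (1 : R) (fun s => dot (a s) (b s)) (dot a' (b t) + dot (a t) b').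
Proof.
move=> ad bd; have ai k := is_derive_mxE k 0 ad; have bi k := is_derive_mxE k 0 bd.
rewrite (_ : (fun _ => _) = fun s => \sum_k a s k 0 * b s k 0); last first.
  by apply/funext => s; rewrite sum3 dotE.
apply: is_derive_eq.
  by apply: is_derive_sumr => k _; exact: is_deriveM.
by rewrite sum3 !dotE /GRing.scale /=; ring.
Qed.

Lemma is_derive_scalemx m n (k : R -> R) (A : R -> 'M[R]_(m, n)) (k' : R)
    (A' : 'M[R]_(m, n)) t :
  is_derive t (1 : R) k k' -> is_derive t (1 : R) A A' ->
  is_derive t (1 : R) (fun s => k s *: A s) (k' *: A t + k t *: A').
Proof.
move=> kd Ad; apply: is_derive_mxP => i j; have Aij := is_derive_mxE i j Ad.
rewrite (_ : (fun _ => _) = fun s => k s * A s i j); last first.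
  by apply/funext => s; rewrite mxE.
by apply: is_derive_eq; rewrite !mxE /GRing.scale /=; ring.
Qed.

Lemma is_derive_att N (X : R -> config R N) (D : config R N) t i :
  is_derive t (1 : R) X D -> is_derive t (1 : R) (fun s => att (X s) i) (att D i).
Proof.
move=> Xd; apply: is_derive_mxP => k l; rewrite attE.
rewrite (_ : (fun _ => _) = fun s => X s i (mxvec_index k l)).
  exact: is_derive_mxE.
by apply/funext => s; rewrite attE.
Qed.

Lemma is_derive_col m n (A : R -> 'M[R]_(m, n)) (A' : 'M[R]_(m, n)) t l :
  is_derive t (1 : R) A A' -> is_derive t (1 : R) (fun s => col l (A s)) (col l A').
Proof.
move=> Ad; apply: is_derive_mxP => i j; rewrite mxE.
rewrite (_ : (fun _ => _) = fun s => A s i l); first exact: is_derive_mxE.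
by apply/funext => s; rewrite mxE.
Qed.

(** A barrier argument: D is only known to be nonnegative where h > c, but h
    cannot leave this region, since it would first have to decrease inside
    it. *)
Lemma nondecreasing_above (h D : R -> R) (L c : R) : 0 < L ->
  (forall s t : R, 0 <= s -> 0 <= t -> `|h t - h s| <= L * `|t - s|) ->
  (forall t, 0 < t -> is_derive t (1 : R) h (D t)) ->
  (forall t, 0 < t -> c < h t -> 0 <= D t) ->
  forall s t, 0 <= s -> s <= t -> c < h s -> h s <= h t.
Proof.
move=> L0 HL hD D0 s t s0 st cs; rewrite leNgt; apply/negP => hts.
pose v := (Num.max c (h t) + h s) / 2.
have mv : Num.max c (h t) < v /\ v < h s.
  have : Num.max c (h t) < h s by rewrite gt_max cs hts.
  by rewrite /v; lra.
have [cv tv] : c < v /\ h t < v by move: mv.1; rewrite gt_max => /andP[].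
have ts0 : 0 <= t - s by rewrite subr_ge0.
have [u [u0 ut vu late]] : exists u, [/\ 0 <= u, u <= t - s, - h (s + u) <= - v &
    forall w, u < w -> w <= t - s -> - v < - h (s + w)].
  apply: (@last_time_below _ (fun u => - h (s + u)) L) => //.
    by rewrite addr0 lerN2 ltW //; case: mv.
  move=> a b a0 b0; rewrite -opprD normrN.
  have -> : h (s + b) + - h (s + a) = h (s + b) - h (s + a) by [].
  by apply: le_trans (HL _ _ _ _) _; rewrite ?addr_ge0 // opprD addrACA subrr add0r.
rewrite lerN2 in vu.
have uts : u < t - s.
  rewrite lt_neqAle ut andbT; apply/eqP => ute.
  by move: vu; rewrite ute addrC subrK leNgt tv.
(* After the last time s + u at which h >= v, the Lipschitz bound keeps h above
   c for a time d, on which h cannot decrease below v. *)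
pose d := Num.min (t - s - u) ((h (s + u) - c) / (2 * L)).
have d0 : 0 < d.
  by rewrite lt_min subr_gt0 uts divr_gt0 ?mulr_gt0 // subr_gt0 (lt_le_trans cv).
have su0 : 0 <= s + u by rewrite addr_ge0.
have above w : s + u <= w -> w <= s + u + d -> c < h w.
  move=> uw wd; have w0 : 0 <= w := le_trans su0 uw.
  have := HL (s + u) w su0 w0; rewrite (@ger0_norm _ (w - _)) ?subr_ge0 // => H.
  have : L * (w - (s + u)) <= L * d by rewrite ler_pM2l //; lra.
  have : L * d <= L * ((h (s + u) - c) / (2 * L)).
    by rewrite ler_pM2l // ge_min lexx orbT.
  have -> : L * ((h (s + u) - c) / (2 * L)) = (h (s + u) - c) / 2.
    by field; rewrite gt_eqF.
  have := ler_norm (- (h w - h (s + u))); rewrite normrN.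
  by move: vu; lra.
have sud : s + u <= s + u + d by rewrite lerDl ltW.
have hd x : x \in `]s + u, s + u + d[ -> is_derive x (1 : R) h (D x).
  by rewrite in_itv /= => /andP[ux _]; apply: hD; exact: le_lt_trans ux.
have hc : {within `[s + u, s + u + d], continuous h}.
  apply: continuous_subspaceW (lipschitz_half_line L0 HL) => x /=.
  by rewrite in_itv /= => /andP[ux _]; exact: le_trans ux.
have [x xin] := MVT (ltr_pwDr d0 (lexx (s + u))) hd hc.
move: xin; rewrite in_itv /= => /andP[ux xd] hx.
have Dx : 0 <= D x.
  by apply: D0; [exact: le_lt_trans ux|apply: above; exact: ltW].
have : h (s + (u + d)) < v.
  rewrite -ltrN2; apply: late; first by rewrite ltr_pwDr.
  by have : d <= t - s - u by [rewrite ge_min lexx]; lra.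
have : 0 <= D x * (s + u + d - (s + u)) by rewrite mulr_ge0 // subr_ge0.
by rewrite addrA; lra.
Qed.

Lemma derivative_of_constant (h : R -> R) (d c t : R) : 0 < t ->
  is_derive t (1 : R) h d -> (forall s, 0 <= s -> h s = c) -> d = 0.
Proof.
move=> t0 hd hc; apply: (is_derive_eq_left t0 hd (is_derive_cst c t 1)) => y y0 _.
by apply: hc; rewrite subrr in y0; exact: ltW.
Qed.

End Derivatives.

Lemma dot_sumr (R : realType) (I : finType) (P : pred I) (a : 'cV[R]_3) (v : I -> 'cV[R]_3) :
  dot a (\sum_(i | P i) v i) = \sum_(i | P i) dot a (v i).
Proof.
apply: (@big_morph _ _ (dot a) 0 +%R 0 +%R); first by move=> u w; exact: dotDr.
by rewrite dotE !mxE; ring.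
Qed.

(** * A Lyapunov function for the axes *)

Section Lyapunov.
Context (R : realType) (N : nat) (e : rel 'I_N) (f : 'I_N -> 'I_N -> R -> R).
Hypotheses (e_sym : symmetric e)
  (f_sym : forall i j, e i j -> forall s : R, 0 <= s -> s <= 2 -> f i j s = f j i s)
  (f_pos : forall i j, e i j -> forall s : R, 0 < s -> s <= 2 -> 0 < f i j s).

Lemma edge_sumC (V : nmodType) (T : 'I_N -> 'I_N -> V) :
  \sum_i \sum_(j | e i j) T i j = \sum_i \sum_(j | e i j) T j i.
Proof.
rewrite (exchange_big_dep xpredT) //=; apply: eq_bigr => i _.
by apply: eq_bigl => j; rewrite e_sym.
Qed.

Section Unit.
Context (x : 'I_N -> 'cV[R]_3) (c : 'cV[R]_3).
Hypotheses (x_unit : forall i, dot (x i) (x i) = 1).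

Lemma gap_bounds i j : 0 <= 1 - dot (x i) (x j) /\ 1 - dot (x i) (x j) <= 2.
Proof.
have := dot_le1 (x_unit i) (x_unit j); have := dot_geN1 (x_unit i) (x_unit j).
by split; lra.
Qed.

Lemma gap_eq0 i j : 1 - dot (x i) (x j) = 0 -> x i = x j.
Proof. by move=> ij; apply: dot_eq1 => //; lra. Qed.

Lemma f_gap_sym i j : e i j ->
  f i j (1 - dot (x i) (x j)) = f j i (1 - dot (x j) (x i)).
Proof.
by move=> eij; rewrite (dotC (x j)); have [? ?] := gap_bounds i j; exact: f_sym.
Qed.

(** The contributions of the ordered edges (i, j) and (j, i) are paired, which
    turns f (<x_j, c> - <x_i, x_j> <x_i, c>) into a product of factors that are
    nonnegative near consensus. *)
Lemma height_derivative :
  2 * \sum_i dot (reduced_field e f x i) c = \sum_i \sum_(j | e i j)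
    f i j (1 - dot (x i) (x j)) * (dot (x i) c + dot (x j) c) * (1 - dot (x i) (x j)).
Proof.
pose T i j := f i j (1 - dot (x i) (x j)) *
  (dot (x j) c - dot (x i) (x j) * dot (x i) c).
have -> : \sum_i dot (reduced_field e f x i) c = \sum_i \sum_(j | e i j) T i j.
  apply: eq_bigr => i _; rewrite /reduced_field dotBl dotZl.
  have dots a : dot a (reduced_control e f x i) =
      \sum_(j | e i j) f i j (1 - dot (x i) (x j)) * dot a (x j).
    by rewrite /reduced_control dot_sumr; apply: eq_bigr => j _; rewrite dotZr.
  rewrite (dotC _ c) !dots mulr_suml -sumrB; apply: eq_bigr => j _.
  by rewrite /T (dotC c (x j)); ring.
rewrite mulrDl mul1r {1}edge_sumC -big_split; apply: eq_bigr => i _.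
rewrite -big_split; apply: eq_bigr => j eij /=.
rewrite /T -f_gap_sym // (dotC (x j) (x i)); ring.
Qed.

Definition height := \sum_i dot (x i) c.

Definition disagreement := \sum_i \sum_(j | e i j) (1 - dot (x i) (x j)).

Lemma disagreement_eq0P :
  disagreement = 0 <-> forall i j, e i j -> x i = x j.
Proof.
split=> [/eqP|xe]; last first.
  rewrite /disagreement big1 // => i _; rewrite big1 // => j eij.
  by rewrite -(xe _ _ eij) x_unit subrr.
have ge0 i j : 0 <= 1 - dot (x i) (x j) by case: (gap_bounds i j).
rewrite psumr_eq0 => [/allP H i j eij|i _]; last exact: sumr_ge0.
have := H i (mem_index_enum _); rewrite /= psumr_eq0 // => /allP/(_ j (mem_index_enum _)).
by rewrite eij => /eqP; exact: gap_eq0.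
Qed.

Hypothesis c_unit : dot c c = 1.

(** Each of the N terms <x_i, c> is at most 1, so a height close to N forces
    every x_i to be close to c. *)
Lemma height_gap i : 1 - dot (x i) c <= N%:R - height.
Proof.
have -> : N%:R - height = \sum_i (1 - dot (x i) c).
  by rewrite sumrB sumr_const card_ord.
rewrite (bigD1 i) //= lerDl sumr_ge0 // => j _.
by have := dot_le1 (x_unit j) c_unit; lra.
Qed.

Lemma disagreement_le_height_gap :
  0 <= disagreement /\ disagreement <= N%:R ^+ 2 * (4 * (N%:R - height)).
Proof.
have ge0 i j : 0 <= 1 - dot (x i) (x j) by case: (gap_bounds i j).
split; first by apply: sumr_ge0 => i _; exact: sumr_ge0.
have gap i j : 1 - dot (x i) (x j) <= 4 * (N%:R - height).
  have := dot_ge0 ((x i - c) + (x j - c)).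
  have -> (u v w : 'cV[R]_3) : dot ((u - w) + (v - w)) ((u - w) + (v - w)) =
      dot u u + dot v v + 4 * dot w w + 2 * dot u v - 4 * dot u w - 4 * dot v w.
    by rewrite !dotE !mx_coords; ring.
  rewrite !x_unit c_unit.
  have := height_gap i; have := height_gap j; lra.
apply: (@le_trans _ _ (\sum_(i < N) \sum_(j < N) 4 * (N%:R - height))).
  apply: ler_sum => i _; rewrite [leRHS](bigID (e i)) /=.
  rewrite -[leLHS]addr0; apply: lerD; first exact: ler_sum.
  by apply: sumr_ge0 => j _; exact: le_trans (gap i j).
by rewrite !sumr_const !card_ord -mulrnA -[leLHS]mulr_natl natrM expr2.
Qed.

Hypothesis height_large : N%:R - 1 < height.

Lemma height_derivative_terms i j : e i j ->
  0 <= f i j (1 - dot (x i) (x j)) * (dot (x i) c + dot (x j) c) * (1 - dot (x i) (x j))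
  ?= iff (1 - dot (x i) (x j) == 0).
Proof.
move=> eij; have [g0 g2] := gap_bounds i j.
have pos k : 0 < dot (x k) c by move: (height_gap k) height_large; lra.
have [->|gN0] := eqVneq (1 - dot (x i) (x j)) 0; first by rewrite mulr0; split; rewrite ?eqxx.
have gpos : 0 < 1 - dot (x i) (x j) by rewrite lt_neqAle eq_sym gN0.
suff p : 0 < f i j (1 - dot (x i) (x j)) * (dot (x i) c + dot (x j) c) * (1 - dot (x i) (x j)).
  by split; [exact: ltW|rewrite eq_sym gt_eqF].
apply: mulr_gt0 => //; apply: mulr_gt0; first exact: f_pos.
exact: addr_gt0.
Qed.

Lemma height_derivative_ge0 : 0 <= \sum_i dot (reduced_field e f x i) c.
Proof.
have : 0 <= 2 * \sum_i dot (reduced_field e f x i) c.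
  rewrite height_derivative; apply: sumr_ge0 => i _; apply: sumr_ge0 => j eij.
  exact: (height_derivative_terms eij).1.
by rewrite pmulr_rge0.
Qed.

Lemma height_derivative_eq0 :
  \sum_i dot (reduced_field e f x i) c = 0 -> disagreement = 0.
Proof.
move=> d0; have /eqP := height_derivative; rewrite d0 mulr0 eq_sym psumr_eq0; last first.
  by move=> i _; apply: sumr_ge0 => j eij; exact: (height_derivative_terms eij).1.
move=> /allP H; apply/disagreement_eq0P => i j eij; apply: gap_eq0.
have := H i (mem_index_enum _); rewrite /= psumr_eq0; last first.
  by move=> k eik; exact: (height_derivative_terms eik).1.
move=> /allP/(_ j (mem_index_enum _)); rewrite eij /= eq_sym.
by rewrite (height_derivative_terms eij).2 => /eqP.
Qed.

End Unit.

End Lyapunov.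

(** * Asymptotic stability of consensus *)

Section Stability.
Context (R : realType) (N : nat) (e : rel 'I_N) (f : 'I_N -> 'I_N -> R -> R)
  (g : 'I_N -> 'I_N -> config R N -> R).
Hypotheses (e_sym : symmetric e) (e_irr : irreflexive e)
  (e_connected : forall i j, connect e i j)
  (f_cont : forall i j, e i j -> continuous (f i j))
  (f_sym : forall i j, e i j -> forall s : R, 0 <= s -> s <= 2 -> f i j s = f j i s)
  (f_pos : forall i j, e i j -> forall s : R, 0 < s -> s <= 2 -> 0 < f i j s)
  (g_lip : forall i j, e i j -> [locally [lipschitz g i j Y | Y in relinfo_dom e i]]).

Let M := SO3N R N.
Let F := closed_loop e f g.
Let W (X : config R N) := disagreement e (xax X).
Let Mc : compact M := @compact_SO3N R N.
Let Fc : {within M, continuous F} := closed_loop_continuous e_irr f_cont g_lip.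

Lemma disagreement_continuous : continuous W.
Proof.
move=> X; apply: (@cvg_sumr _ _ _ _ (nbhs X)) => i _.
apply: (@cvg_sumr _ _ _ _ (nbhs X)) => j _.
have xc k : xax Y k @[Y --> X] --> xax X k.
  exact: (@cvg_xax R _ (nbhs X) _ N id X k cvg_id).
exact: (cvgB (cvg_cst (1 : R)) (cvg_dot (xc i) (xc j))).
Qed.

Lemma height_continuous c : continuous (fun X : config R N => height (xax X) c).
Proof.
move=> X; apply: (@cvg_sumr _ _ _ _ (nbhs X)) => i _.
have xc k : xax Y k @[Y --> X] --> xax X k.
  exact: (@cvg_xax R _ (nbhs X) _ N id X k cvg_id).
exact: (cvg_dot (xc i) (cvg_cst c)).
Qed.

Lemma height_along c X (t : R) : trajectory M F X -> 0 < t ->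
  is_derive t (1 : R) (fun s => height (xax (X s)) c)
    (\sum_i dot (reduced_field e f (xax (X t)) i) c).
Proof.
move=> [_ XM XF] t0; have Xd := XF t t0.
apply: is_derive_sumr => i _.
have := is_derive_dot (is_derive_col 0 (is_derive_att i Xd)) (is_derive_cst c t 1).
rewrite -/(xax _ i) xax_closed_loop; last exact/XM/ltW.
by move=> H; apply: is_derive_eq H _; rewrite [X in _ + X]dotE !mxE; ring.
Qed.

Lemma height_lipschitz c X : dot c c = 1 -> trajectory M F X ->
  exists2 L : R, 0 < L & forall s t, 0 <= s -> 0 <= t ->
  `|height (xax (X t)) c - height (xax (X s)) c| <= L * `|t - s|.
Proof.
move=> c1 Xt; have [L L0 HL] := trajectory_lipschitz Mc Fc.
exists (N%:R * (3 * L) + 1) => [|s t s0 t0].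
  by rewrite ltr_wpDl // mulr_ge0 // mulr_ge0 // ltW.
have ck k : `|c k 0| <= 1.
  have : c k 0 ^+ 2 <= 1.
    move: c1; rewrite dotE -!expr2; move: k; apply: forall_ord3;
    by have := sqr_ge0 (c 0 0); have := sqr_ge0 (c 1 0); have := sqr_ge0 (c 2 0); lra.
  by rewrite -real_normK ?num_real // -[leRHS](expr1n _ 2) ler_pXn2r // nnegrE.
rewrite /height -sumrB; apply: (@le_trans _ _ (N%:R * (3 * (L * `|t - s|)))).
  apply: le_trans (ler_norm_sum _ _ _) _.
  have -> : N%:R * (3 * (L * `|t - s|)) = \sum_(i < N) 3 * (L * `|t - s|).
    by rewrite sumr_const card_ord mulr_natl.
  apply: ler_sum => i _; rewrite -dotBl.
  have xk k : `|(xax (X t) i - xax (X s) i) k 0 * c k 0| <= L * `|t - s|.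
    rewrite normrM -[leRHS]mulr1 ler_pM //.
    rewrite mx_addE mx_oppE !xaxE; apply: le_trans (HL X Xt s t s0 t0).
    by have := mx_entry_le (X t - X s) i (mxvec_index k 0); rewrite mx_addE mx_oppE.
  rewrite dotE; apply: le_trans (ler_normD _ _) _.
  have := ler_normD ((xax (X t) i - xax (X s) i) 0 0 * c 0 0)
    ((xax (X t) i - xax (X s) i) 1 0 * c 1 0).
  by have := xk 0; have := xk 1; have := xk 2; lra.
rewrite [leRHS](_ : _ = N%:R * (3 * (L * `|t - s|)) + `|t - s|); last by ring.
by rewrite lerDl.
Qed.

Lemma height_nondecreasing c X : dot c c = 1 -> trajectory M F X ->
  N%:R - 1 < height (xax (X 0)) c -> forall s t, 0 <= s -> s <= t ->
  height (xax (X s)) c <= height (xax (X t)) c.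
Proof.
move=> c1 Xt h0; have [L L0 HL] := height_lipschitz c1 Xt.
have unit t i : 0 <= t -> dot (xax (X t) i) (xax (X t) i) = 1.
  by move=> t0; apply: xax_unit; case: Xt => _ + _; apply.
have mono := nondecreasing_above L0 HL (fun t t0 => height_along c Xt t0)
  (fun t t0 => height_derivative_ge0 e_sym f_sym f_pos (fun i => unit t i (ltW t0)) c1).
move=> s t s0 st; apply: (mono) => //.
exact: lt_le_trans h0 (mono 0 s (lexx 0) s0 h0).
Qed.

Lemma height_constant c Y : dot c c = 1 -> trajectory M F Y ->
  N%:R - 1 < height (xax (Y 0)) c ->
  (forall t, 0 <= t -> height (xax (Y t)) c = height (xax (Y 0)) c) ->
  W (Y 0) = 0.
Proof.
move=> c1 Yt h0 hc.
have W0 (t : R) : 0 < t -> W (Y t) = 0.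
  move=> t0; apply: (height_derivative_eq0 e_sym f_sym f_pos (c := c)) => //.
  - by move=> i; apply: xax_unit; case: Yt => _ + _; apply; exact: ltW.
  - by rewrite hc // ltW.
  - exact: (derivative_of_constant t0 (height_along c Yt t0) hc).
(* Trajectories are differentiable for t > 0 only; time 0 is reached by
   continuity. *)
have [/subspace_continuousP/(_ 0 (lexx 0)) Y0 _ _] := Yt.
have WY : W (Y t) @[t --> 0^'+] --> W (Y 0).
  apply: (@continuous_cvg _ _ _ (0^'+) _ Y W); first exact: disagreement_continuous.
  move=> P /Y0 H; have : nbhs (0 : R) (fun t => 0 <= t -> P (Y t)) := H.
  by apply: (@filterS _ (nbhs (0 : R))) => t /= Pt t0; apply: Pt; exact: ltW.
apply: (@cvg_unique _ (@Rhausdorff R) _ _ _ _ WY).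
apply: cvg_near_cst; near=> t; apply: W0.
by near: t; exact: nbhs_right_gt.
Unshelve. all: by end_near. Qed.

Lemma consensus_xax (y : config R N) i j : consensus e y -> xax y i = xax y j.
Proof.
move=> [_ al]; have /connectP[p + ->] := e_connected i j.
elim: p i => [//|k p IH] i /= /andP[eik /IH <-].
by rewrite /xax (al _ _ eik).
Qed.

Lemma height_in_tube (i0 : 'I_N) (delta : R) (y X : config R N) : consensus e y -> ball y delta X ->
  N%:R - height (xax X) (xax y i0) <= N%:R * (3 * delta).
Proof.
move=> Cy; rewrite -ball_normE /= => yX.
have y1 := xax_unit i0 Cy.1.
have yk k : `|xax y i0 k 0| <= 1 by rewrite mxE; apply: SO3_entry; exact: Cy.1.
have -> : N%:R - height (xax X) (xax y i0) =
    \sum_i dot (xax y i - xax X i) (xax y i0).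
  rewrite (eq_bigr (fun i => 1 - dot (xax X i) (xax y i0))).
    by rewrite sumrB sumr_const card_ord.
  by move=> i _; rewrite dotBl (consensus_xax i i0 Cy) y1.
have -> : N%:R * (3 * delta) = \sum_(i < N) 3 * delta.
  by rewrite sumr_const card_ord mulr_natl.
apply: ler_sum => i _.
have d k : (xax y i - xax X i) k 0 * xax y i0 k 0 <= delta.
  apply: le_trans (ler_norm _) _; rewrite normrM -[leRHS]mulr1 ler_pM //.
  rewrite mx_addE mx_oppE !xaxE; apply: le_trans (ltW yX).
  by have := mx_entry_le (y - X) i (mxvec_index k 0); rewrite mx_addE mx_oppE.
by rewrite dotE; have := d 0; have := d 1; have := d 2; lra.
Qed.

Theorem consensus_asymptotically_stable : (0 < N)%N ->
  asymptotically_stable (aligned e) (great_circle e g) (consensus e) ->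
  asymptotically_stable M F (consensus e).
Proof.
move=> N0; pose i0 := Ordinal N0.
have Wc : {within M, continuous W}.
  by apply: continuous_subspaceT; exact: disagreement_continuous.
have MX X t : trajectory M F X -> 0 <= t -> M (X t) by case=> _ + _; apply.
have start delta X : trajectory M F X -> tube (consensus e) delta (X 0) ->
    exists2 c, dot c c = 1 & N%:R - height (xax (X 0)) c <= N%:R * (3 * delta).
  by move=> Xt [y Cy yX]; exists (xax y i0); [exact: xax_unit Cy.1|exact: height_in_tube].
have NR0 : 0 < N%:R :> R by rewrite ltr0n.
have start1 delta X : delta <= (4 * N%:R)^-1 -> trajectory M F X ->
    tube (consensus e) delta (X 0) ->
    exists2 c, dot c c = 1 & N%:R - height (xax (X 0)) c <= N%:R * (3 * delta) /\
      N%:R - 1 < height (xax (X 0)) c.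
  move=> dN Xt /(start _ _ Xt)[c c1 hc]; exists c => //; split=> //.
  have : N%:R * (3 * delta) <= 3 / 4.
    rewrite [leRHS](_ : _ = N%:R * (3 * (4 * N%:R)^-1)); last by field; rewrite gt_eqF.
    by rewrite ler_pM2l // ler_pM2l.
  lra.
have d4 : 0 < (4 * N%:R)^-1 :> R by rewrite invr_gt0 mulr_gt0.
apply: (asymptotic_stability_reduction Mc Fc Wc).
- move=> X; split=> [[SX al]|[SX W0]]; split=> //.
    by apply/disagreement_eq0P => //; move=> i; exact: xax_unit.
  by apply/disagreement_eq0P => //; move=> i; exact: xax_unit.
- by move=> X AX; exact: closed_loop_aligned.
- move=> eta eta0; pose K : R := N%:R ^+ 2 * (4 * (N%:R * 3)).
  have K0 : 0 < K by rewrite !mulr_gt0 // exprn_gt0.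
  (* The first bound gives V > N - 1 at time 0, the second one W < eta. *)
  exists (Num.min (4 * N%:R)^-1 (eta / (2 * K))).
    by rewrite lt_min d4 divr_gt0 // mulr_gt0.
  set delta := Num.min _ _ => X Xt X0 t t0.
  have [|c c1 [hc hl]] := @start1 delta X _ Xt X0; first by rewrite ge_min lexx.
  have unit i : dot (xax (X t) i) (xax (X t) i) = 1 by apply: xax_unit; exact: MX.
  have [W0 WN] := disagreement_le_height_gap e unit c1.
  rewrite ger0_norm //; apply: le_lt_trans WN _.
  have ht := height_nondecreasing c1 Xt hl (lexx 0) t0.
  have gap : N%:R - height (xax (X t)) c <= N%:R * (3 * delta) by lra.
  apply: (@le_lt_trans _ _ (K * delta)).
    rewrite [leRHS](_ : _ = N%:R ^+ 2 * (4 * (N%:R * (3 * delta)))); last by rewrite /K; ring.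
    by rewrite ler_pM2l ?exprn_gt0 // ler_pM2l.
  apply: (@le_lt_trans _ _ (K * (eta / (2 * K)))).
    by rewrite ler_pM2l // ge_min lexx orbT.
  rewrite [ltLHS](_ : _ = eta / 2); last by field; rewrite gt_eqF.
  by rewrite ltr_pdivrMr // ltr_pMr // ltr1n.
- exists (4 * N%:R)^-1 => // X Xt X0.
  have [c c1 [hc hl]] := start1 _ _ (lexx _) Xt X0.
  apply: (lasalle Mc Fc Wc (V := fun X => height (xax X) c)) => //.
  + by apply: continuous_subspaceT; exact: height_continuous.
  + exact: height_nondecreasing.
  + move=> Y Yt hY hc'; apply: (height_constant c1 Yt) => //.
    exact: lt_le_trans hY.
Qed.

End Stability.

(** * Linearizations along curves *)

Lemma mx_linear_bounded (R : realType) m n m' n'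
    (A : {linear 'M[R]_(m, n) -> 'M[R]_(m', n')}) :
  exists2 K : R, 0 < K & forall v, `|A v| <= K * `|v|.
Proof.
pose K := \sum_i \sum_j `|A (delta_mx i j)|.
have K0 : 0 <= K by apply: sumr_ge0 => i _; apply: sumr_ge0.
exists (K + 1) => [|v]; first by rewrite ltr_wpDl.
apply: (@le_trans _ _ (K * `|v|)); last by rewrite ler_wpM2r // lerDl.
rewrite {1}[v]matrix_sum_delta linear_sum mulr_suml.
apply: le_trans (ler_norm_sum _ _ _) _; apply: ler_sum => i _.
rewrite linear_sum mulr_suml.
apply: le_trans (ler_norm_sum _ _ _) _; apply: ler_sum => j _.
by rewrite linearZ normrZ mulrC ler_wpM2l //; exact: mx_entry_le.
Qed.

(** Curves in M probe a linearization on tangent vectors, where it is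
    determined by F. *)
Lemma linearization_curve (R : realType) m n (M : set 'M[R]_(m, n))
    (F : 'M[R]_(m, n) -> 'M[R]_(m, n)) p A (gamma : R -> 'M[R]_(m, n)) v :
  linearization M F p A -> gamma 0 = p -> (forall t, M (gamma t)) ->
  is_derive (0 : R) (1 : R) gamma v ->
  is_derive (0 : R) (1 : R) (fun t => F (gamma t)) (A v).
Proof.
move=> FA g0 gM /is_deriveP gv; apply/is_deriveP => eps eps0.
have [K K0 HK] := mx_linear_bounded A.
have v0 : 0 < `|v| + 1 by rewrite ltr_wpDl.
have e1 : 0 < eps / (2 * (`|v| + 1)) by rewrite divr_gt0 // mulr_gt0.
have e2 : 0 < eps / (2 * K) by rewrite divr_gt0 // mulr_gt0.
have [d1 d10 H1] := gv _ (@ltr01 R); have [d2 d20 H2] := gv _ e2.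
have /nbhs_ballP[r /= r0 Hr] := FA _ e1.
exists (Num.min (Num.min d1 d2) (r / (`|v| + 1))) => [|h].
  by rewrite !lt_min d10 d20 divr_gt0.
rewrite !lt_min -andbA => /and3P[hd1 hd2 hr].
have gap : `|gamma h - p| <= (`|v| + 1) * `|h|.
  have := H1 h hd1; rewrite add0r g0 mul1r => Hh.
  rewrite -(subrK (h *: v) (gamma h - p)); apply: le_trans (ler_normD _ _) _.
  by rewrite normrZ mulrDl mul1r addrC mulrC lerD2l.
rewrite add0r g0.
have -> : F (gamma h) - F p - h *: A v =
    (F (gamma h) - F p - A (gamma h - p)) + A (gamma h - p - h *: v).
  have -> : A (gamma h - p - h *: v) = A (gamma h - p) - h *: A v.
    have AZ : A (h *: v) = h *: A v by rewrite linearZ_LR.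
    by rewrite -AZ; exact: raddfB.
  by rewrite [RHS]addrA subrK.
apply: le_trans (ler_normD _ _) _; rewrite [eps in leRHS]splitr mulrDl; apply: lerD.
  apply: (@le_trans _ _ (eps / (2 * (`|v| + 1)) * `|gamma h - p|)).
    apply: Hr => //; rewrite -ball_normE /= distrC.
    by apply: le_lt_trans gap _; rewrite mulrC -ltr_pdivlMr.
  apply: (@le_trans _ _ (eps / (2 * (`|v| + 1)) * ((`|v| + 1) * `|h|))).
    by rewrite ler_pM2l.
  by rewrite le_eqVlt; apply/orP; left; apply/eqP; field; rewrite gt_eqF.
apply: le_trans (HK _) _.
have := H2 h hd2; rewrite add0r g0 -(ler_pM2l K0) => /le_trans; apply.
by rewrite le_eqVlt; apply/orP; left; apply/eqP; field; rewrite gt_eqF.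
Qed.

Lemma is_derive_mulmx (R : realType) m n k (A : R -> 'M[R]_(m, n))
    (B : R -> 'M[R]_(n, k)) (A' : 'M[R]_(m, n)) (B' : 'M[R]_(n, k)) t :
  is_derive t (1 : R) A A' -> is_derive t (1 : R) B B' ->
  is_derive t (1 : R) (fun s => A s *m B s) (A' *m B t + A t *m B').
Proof.
move=> Ad Bd; apply: is_derive_mxP => i j.
rewrite (_ : (fun _ => _) = fun s => \sum_l A s i l * B s l j); last first.
  by apply/funext => s; rewrite mxE.
have Al l := is_derive_mxE i l Ad; have Bl l := is_derive_mxE l j Bd.
apply: is_derive_eq.
  by apply: is_derive_sumr => l _; exact: is_deriveM.
rewrite !mxE -big_split; apply: eq_bigr => l _ /=.
by rewrite /GRing.scale /=; ring.
Qed.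

Lemma is_derive_trmx (R : realType) m n (A : R -> 'M[R]_(m, n)) (A' : 'M[R]_(m, n)) t :
  is_derive t (1 : R) A A' -> is_derive t (1 : R) (fun s => (A s)^T) A'^T.
Proof.
move=> Ad; apply: is_derive_mxP => i j; rewrite mxE.
rewrite (_ : (fun _ => _) = fun s => A s j i); first exact: is_derive_mxE.
by apply/funext => s; rewrite mxE.
Qed.

Lemma is_derive_tuple_mx (R : realType) N (Q : R -> 'I_N -> 'M[R]_3)
    (D : 'I_N -> 'M[R]_3) t :
  (forall i, is_derive t (1 : R) (Q ^~ i) (D i)) ->
  is_derive t (1 : R) (fun s => tuple_mx (Q s)) (tuple_mx D).
Proof.
move=> QD; apply: is_derive_mxP => i kl; case/mxvec_indexP: kl => k l.
rewrite mxE mxvecE (_ : (fun _ => _) = fun s => Q s i k l).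
  exact: is_derive_mxE.
by apply/funext => s; rewrite mxE mxvecE.
Qed.

(** * Curves of rotations *)

Section Cayley.
Context (R : realType).
Implicit Types (b w : 'cV[R]_3).

(** The Cayley transform (1 + spin b) (1 - spin b)^-1, written without inverse
    matrices: a rational curve of rotations through the identity, defined for all
    times and with any prescribed velocity. *)
Definition cayley b : 'M[R]_3 := 1%:M +
  (1 + dot b b)^-1 *: (2 *: spin b + 2 *: (b *m b^T) - (2 * dot b b)%:M).

Lemma cayley_SO3 b : SO3 (cayley b).
Proof.
have q0 : 1 + dot b b != 0 by rewrite gt_eqF // ltr_pwDl // dot_ge0.
have entry : forall k l, cayley b k l = (k == l)%:R + (1 + dot b b)^-1 *
    (2 * spin b k l + 2 * (b k 0 * b l 0) - (2 * dot b b) * (k == l)%:R).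
  by move=> k l; rewrite /cayley !mxE big_ord1 !mxE mulr_natr.
move: q0; rewrite dotE => q0; split.
  apply/matrixP; apply: forall_ord3; apply: forall_ord3;
    rewrite [LHS]mxE sum3 ![(cayley b)^T _ _]mxE !entry [RHS]mxE dotE !mxE /=; by field.
rewrite det3E dotE !cross_coords ![col _ _ _ _]mxE !entry dotE !mxE /=; by field.
Qed.

Lemma cayley0 : cayley 0 = 1%:M.
Proof.
have d0 : dot (0 : 'cV[R]_3) 0 = 0 by rewrite dotE !mxE; ring.
have s0 : spin (0 : 'cV[R]_3) = 0 by rewrite -(scale0r (0 : 'cV[R]_3)) spinZ scale0r.
have z : (0 : R)%:M = 0 :> 'M[R]_3 by exact: raddf0.
by rewrite /cayley d0 s0 mul0mx mulr0 z subr0 !(scaler0, addr0).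
Qed.

Lemma is_derive_cayley w :
  is_derive (0 : R) (1 : R) (fun t => cayley ((t / 2) *: w)) (spin w).
Proof.
apply/is_derive_quotientP.
pose B t : 'M[R]_3 := (1 + t ^+ 2 * (dot w w / 4))^-1 *:
  (spin w + t *: (2^-1 *: (w *m w^T) - (dot w w / 2)%:M)).
have quot t : t != 0 -> t^-1 *: (cayley (((0 + t) / 2) *: w) - cayley ((0 / 2) *: w)) = B t.
  move=> t0; rewrite mul0r scale0r cayley0 add0r /cayley addrC addKr.
  rewrite dotZl dotZr /B [LHS]scalerA [t^-1 * _]mulrC -[LHS]scalerA.
  rewrite (_ : t / 2 * (t / 2 * dot w w) = t ^+ 2 * (dot w w / 4)); last by field.
  congr (_ *: _); apply/matrixP => k l; rewrite spinZ.
  rewrite !mxE !big_ord1 !mxE; by field.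
have Blim : B t @[t --> 0^'] --> B 0.
  have t0 : (t : R) @[t --> 0^'] --> (0 : R) by exact: cvg_within.
  have r0 : 1 + t ^+ 2 * (dot w w / 4) @[t --> 0^'] --> 1 + (0 : R) ^+ 2 * (dot w w / 4).
    exact: (cvgD (cvg_cst (1 : R)) (cvgM (cvgM t0 t0) (cvg_cst (dot w w / 4)))).
  have rN0 : 1 + (0 : R) ^+ 2 * (dot w w / 4) != 0.
    by rewrite expr0n /= mul0r addr0 oner_neq0.
  apply: (cvg_scalemx (cvgV rN0 r0)); apply: cvgD; first exact: cvg_cst.
  by apply: (cvg_scalemx t0); exact: cvg_cst.
have B0 : B 0 = spin w by rewrite /B scale0r addr0 expr0n /= mul0r addr0 invr1 scale1r.
rewrite -B0; apply: cvg_trans Blim; apply: near_eq_cvg.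
near=> t; apply/esym/quot; near: t; exact: nbhs_dnbhs_neq.
Unshelve. all: by end_near. Qed.

End Cayley.

(** * Linearization of the flow of the axes *)

Section ReducedLinearization.
Context (R : realType) (N : nat) (e : rel 'I_N) (f : 'I_N -> 'I_N -> R -> R).

Let df i j s := derive1 (f i j) s.

Definition reduced_control_diff (x v : 'I_N -> 'cV[R]_3) i : 'cV[R]_3 := \sum_(j | e i j)
  ((df i j (1 - dot (x i) (x j)) * - (dot (v i) (x j) + dot (x i) (v j))) *: x j +
   f i j (1 - dot (x i) (x j)) *: v j).

Definition reduced_field_diff (x v : 'I_N -> 'cV[R]_3) i : 'cV[R]_3 := reduced_control_diff x v i -
  ((dot (v i) (reduced_control e f x i) + dot (x i) (reduced_control_diff x v i)) *: x i +
   dot (x i) (reduced_control e f x i) *: v i).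

Hypothesis f_der : forall i j, e i j -> forall s : R, is_derive s (1 : R) (f i j) (df i j s).

Lemma is_derive_reduced_field (x : R -> 'I_N -> 'cV[R]_3) (v : 'I_N -> 'cV[R]_3) (t : R) i :
  (forall j, is_derive t (1 : R) (x ^~ j) (v j)) ->
  is_derive t (1 : R) (fun s => reduced_field e f (x s) i) (reduced_field_diff (x t) v i).
Proof.
move=> xv.
have ud : is_derive t (1 : R) (fun s => reduced_control e f (x s) i) (reduced_control_diff (x t) v i).
  apply: is_derive_sumr => j eij.
  have dd := is_derive_dot (xv i) (xv j).
  have sd : is_derive t (1 : R) (fun s => 1 - dot (x s i) (x s j))
      (- (dot (v i) (x t j) + dot (x t i) (v j))).
    by have := is_deriveB (is_derive_cst (1 : R) t (1 : R)) dd; rewrite sub0r.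
  exact: (is_derive_scalemx (is_derive1_comp (f_der eij _) sd) (xv j)).
have := is_deriveB ud (is_derive_scalemx (is_derive_dot (xv i) ud) (xv i)).
exact.
Qed.

(** The linearized flow of the axes as a bilinear form on tangent families; its
    components along x_i, invisible to tangent w, are left out. *)
Definition linearized_form (x v w : 'I_N -> 'cV[R]_3) : R := \sum_i \sum_(j | e i j)
  (f i j (1 - dot (x i) (x j)) * dot (v j) (w i)
   - df i j (1 - dot (x i) (x j)) * (dot (v i) (x j) + dot (x i) (v j)) * dot (x j) (w i)
   - f i j (1 - dot (x i) (x j)) * dot (x i) (x j) * dot (v i) (w i)).

Lemma linearized_formE x v w : (forall i, dot (x i) (w i) = 0) ->
  \sum_i dot (w i) (reduced_field_diff x v i) = linearized_form x v w.
Proof.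
move=> xw; apply: eq_bigr => i _; rewrite /reduced_field_diff dotBr dotDr !dotZr (dotC _ (x i)) xw.
rewrite mulr0 add0r {1}/reduced_control_diff dot_sumr /reduced_control dot_sumr mulr_suml -sumrB.
apply: eq_bigr => j _; rewrite dotDr !dotZr (dotC (w i)) (dotC (w i)) (dotC (w i)); ring.
Qed.

Section AtUnitVectors.
Context (x : 'I_N -> 'cV[R]_3).
Hypotheses (e_sym : symmetric e) (x_unit : forall i, dot (x i) (x i) = 1)
  (f_sym : forall i j, e i j -> forall s : R, 0 <= s -> s <= 2 -> f i j s = f j i s)
  (df_sym : forall i j, e i j -> forall s : R, 0 < s -> s <= 2 -> df i j s = df j i s)
  (f_gain : forall i j, e i j -> forall s : R, 0 < s -> s <= 2 ->
     0 < s ^+ 2 * f i j s - (2 - s) * s ^+ 2 * df i j s).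

(** Terms exchange under (i, j) <-> (j, i) because the gains are symmetric.  At
    s = 0, where the derivatives of f_ij and f_ji may differ, x_i = x_j and the
    term vanishes on tangent vectors. *)
Lemma linearized_formC v w : (forall i, dot (x i) (v i) = 0) ->
  (forall i, dot (x i) (w i) = 0) -> linearized_form x v w = linearized_form x w v.
Proof.
move=> xv xw; pose fx i j := f i j (1 - dot (x i) (x j)).
pose dfx i j := df i j (1 - dot (x i) (x j)).
pose T v w i j := fx i j * dot (v j) (w i).
pose P v w i j := dfx i j * dot (v i) (x j) * dot (x j) (w i).
pose Q v w i j := dfx i j * dot (x i) (v j) * dot (x j) (w i).
pose D v w i j := fx i j * dot (x i) (x j) * dot (v i) (w i).
have split v' w' : linearized_form x v' w' = \sum_i \sum_(j | e i j) T v' w' i j -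
    \sum_i \sum_(j | e i j) P v' w' i j - \sum_i \sum_(j | e i j) Q v' w' i j -
    \sum_i \sum_(j | e i j) D v' w' i j.
  rewrite -!sumrB; apply: eq_bigr => i _; rewrite -!sumrB; apply: eq_bigr => j _.
  by rewrite /T /P /Q /D /fx /dfx; ring.
have fxC i j : e i j -> fx i j = fx j i.
  by move=> eij; exact: (f_gap_sym f_sym x_unit eij).
have TC : \sum_i \sum_(j | e i j) T v w i j = \sum_i \sum_(j | e i j) T w v i j.
  rewrite (edge_sumC e_sym); apply: eq_bigr => i _; apply: eq_bigr => j eij.
  by rewrite /T -(fxC i j eij) dotC.
have PC : \sum_i \sum_(j | e i j) P v w i j = \sum_i \sum_(j | e i j) P w v i j.
  apply: eq_bigr => i _; apply: eq_bigr => j eij.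
  by rewrite /P (dotC (v i)) (dotC (w i)); ring.
have QC : \sum_i \sum_(j | e i j) Q v w i j = \sum_i \sum_(j | e i j) Q w v i j.
  rewrite (edge_sumC e_sym); apply: eq_bigr => i _; apply: eq_bigr => j eij.
  rewrite /Q; have [s0 s2] := gap_bounds x_unit i j.
  have [/(gap_eq0 x_unit) xij|sN0] := eqVneq (1 - dot (x i) (x j)) 0.
    have -> : dot (x j) (v i) = 0 by rewrite -xij xv.
    by rewrite !mulr0 mul0r.
  rewrite /dfx (dotC (x j) (x i)) (df_sym eij) //; first by ring.
  by rewrite lt_neqAle eq_sym sN0.
have DC : \sum_i \sum_(j | e i j) D v w i j = \sum_i \sum_(j | e i j) D w v i j.
  by apply: eq_bigr => i _; apply: eq_bigr => j eij; rewrite /D (dotC (v i)).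
by rewrite !split TC PC QC DC.
Qed.

Definition tangent_part (v : 'I_N -> 'cV[R]_3) i : 'cV[R]_3 :=
  v i - dot (x i) (v i) *: x i.

Lemma tangent_part_orth v i : dot (x i) (tangent_part v i) = 0.
Proof. by rewrite dotBr dotZr x_unit mulr1 subrr. Qed.

(** The test vectors are the infinitesimal translations of all x_i by a
    basis vector, projected on the sphere.  The sum over the basis only involves
    inner products of x_i and x_j, hence s. *)
Lemma linearized_form_trace :
  \sum_k linearized_form x (tangent_part (fun=> delta_mx k 0)) (tangent_part (fun=> delta_mx k 0)) =
  \sum_i \sum_(j | e i j) ((1 - dot (x i) (x j)) ^+ 2 * f i j (1 - dot (x i) (x j)) -
    (2 - (1 - dot (x i) (x j))) * (1 - dot (x i) (x j)) ^+ 2 * df i j (1 - dot (x i) (x j))).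
Proof.
rewrite exchange_big; apply: eq_bigr => i _.
rewrite exchange_big; apply: eq_bigr => j _.
have dk (a : 'cV[R]_3) k : dot a (delta_mx k 0) = a k 0.
  by move: k; apply: forall_ord3; rewrite dotE !mxE /=; ring.
have dkl k (a : 'cV[R]_3) : dot (delta_mx k 0) a = a k 0 by rewrite dotC dk.
set c := dot (x i) (x j); set F := f i j _; set G := df i j _.
have entry (y : 'cV[R]_3) l k : (delta_mx k 0 - l *: y) k 0 = 1 - l * y k 0.
  by rewrite !mx_coords mxE !eqxx.
rewrite (eq_bigr (fun k => F * (1 - x i k 0 ^+ 2 - x j k 0 ^+ 2 + c * (x i k 0 * x j k 0)) -
    G * (1 - c) * (x i k 0 + x j k 0) * (x j k 0 - c * x i k 0) -
    F * c * (1 - x i k 0 ^+ 2))); last first.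
  move=> k _; rewrite /tangent_part.
  rewrite !(dotBl, dotBr, dotZl, dotZr, dk, dkl, entry) !x_unit (dotC (x j) (x i)) -/c.
  by ring.
have : dot (x i) (x j) = c by []; have := x_unit i; have := x_unit j; rewrite sum3 !dotE.
move: (x i 0 0) (x i 1 0) (x i 2 0) (x j 0 0) (x j 1 0) (x j 2 0).
move=> a0 a1 a2 b0 b1 b2 bb aa ab.
(* a and b are the coordinates of x_i and x_j; the sums |x_i|^2, |x_j|^2 and
   <x_i, x_j> are isolated before they are replaced by 1, 1 and c. *)
transitivity (F * (3 - (a0 * a0 + a1 * a1 + a2 * a2) - (b0 * b0 + b1 * b1 + b2 * b2) +
    c * (a0 * b0 + a1 * b1 + a2 * b2)) -
  G * (1 - c) * ((a0 * b0 + a1 * b1 + a2 * b2) - c * (a0 * a0 + a1 * a1 + a2 * a2) +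
    (b0 * b0 + b1 * b1 + b2 * b2) - c * (a0 * b0 + a1 * b1 + a2 * b2)) -
  F * c * (3 - (a0 * a0 + a1 * a1 + a2 * a2))); first by ring.
by rewrite aa bb ab; ring.
Qed.

Lemma linearized_form_positive_direction i0 j0 : e i0 j0 -> x i0 <> x j0 ->
  exists k, 0 < linearized_form x (tangent_part (fun=> delta_mx k 0)) (tangent_part (fun=> delta_mx k 0)).
Proof.
move=> e0 x0.
have term i j : e i j -> 0 <= (1 - dot (x i) (x j)) ^+ 2 * f i j (1 - dot (x i) (x j)) -
    (2 - (1 - dot (x i) (x j))) * (1 - dot (x i) (x j)) ^+ 2 * df i j (1 - dot (x i) (x j))
    ?= iff (1 - dot (x i) (x j) == 0).
  move=> eij; have [s0 s2] := gap_bounds x_unit i j.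
  have [->|sN0] := eqVneq (1 - dot (x i) (x j)) 0.
    by rewrite expr0n /= mulr0 !mul0r subrr; split; rewrite ?eqxx.
  have sp : 0 < 1 - dot (x i) (x j) by rewrite lt_neqAle eq_sym sN0.
  have := f_gain eij sp s2; set u := _ - _ => u0.
  by split; [exact: ltW|rewrite eq_sym gt_eqF].
apply: contrapT => nopos.
have : \sum_k linearized_form x (tangent_part (fun=> delta_mx k 0)) (tangent_part (fun=> delta_mx k 0)) <= 0.
  apply: sumr_le0 => k _; rewrite leNgt; apply/negP => kp; apply: nopos; by exists k.
rewrite linearized_form_trace; apply/negP; rewrite -ltNge.
rewrite (bigD1 i0) //= (bigD1 j0) //= -addrA ltr_wpDr //.
  apply: addr_ge0; first by apply: sumr_ge0 => j /andP[eij _]; exact: (term _ _ eij).1.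
  by apply: sumr_ge0 => i _; apply: sumr_ge0 => j eij; exact: (term _ _ eij).1.
rewrite lt_neqAle (term _ _ e0).1 andbT (term _ _ e0).2.
by apply/eqP => /(gap_eq0 x_unit).
Qed.

(** Composing the form with the projection on tangent vectors extends it to all
    families of vectors; the eigenvector it yields for mu > 0 is tangent, being
    orthogonal to the normal vectors, on which the form vanishes. *)
Lemma linearized_form_eigenvector i0 j0 : e i0 j0 -> x i0 <> x j0 ->
  exists mu (b : 'I_N -> 'cV[R]_3), [/\ 0 < mu, forall i, dot (x i) (b i) = 0,
    exists i, b i != 0 & forall v, (forall i, dot (x i) (v i) = 0) ->
    linearized_form x v b = mu * \sum_i dot (b i) (v i)].
Proof.
move=> e0 x0.
pose vec (V : 'M[R]_(N, 3)) i : 'cV[R]_3 := (row i V)^T.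
pose B V W := linearized_form x (tangent_part (vec V)) (tangent_part (vec W)).
have BDl a U V W : B (a *: U + V) W = a * B U W + B V W.
  rewrite /B /linearized_form mulr_sumr -big_split; apply: eq_bigr => i _ /=.
  rewrite mulr_sumr -big_split; apply: eq_bigr => j _ /=.
  have vecD k : tangent_part (vec (a *: U + V)) k =
      a *: tangent_part (vec U) k + tangent_part (vec V) k.
    rewrite /tangent_part /vec !linearP dotDr dotZr scalerBr scalerDl scalerA.
    by rewrite opprD addrACA.
  by rewrite !vecD !(dotDl, dotDr, dotZl, dotZr); ring.
have BC V W : B V W = B W V by apply: linearized_formC => i; exact: tangent_part_orth.
have [k Bk] := linearized_form_positive_direction e0 x0.
pose mx (v : 'I_N -> 'cV[R]_3) : 'M[R]_(N, 3) := \matrix_(i, l) v i l 0.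
have vecK v : vec (mx v) = v.
  by apply/funext => i; apply/matrixP => l z; rewrite !mxE ord1.
have dotv V v : mxdot V (mx v) = \sum_i dot (vec V i) (v i).
  by apply: eq_bigr => i _; rewrite dotE sum3 !mxE.
have tangentK v : (forall i, dot (x i) (v i) = 0) -> tangent_part v = v.
  by move=> xv; apply/funext => i; rewrite /tangent_part xv scale0r subr0.
have Bpos : 0 < B (mx (fun=> delta_mx k 0)) (mx (fun=> delta_mx k 0)).
  by rewrite /B !vecK.
have [mu [b [mu0 bN0 Hb]]] := rayleigh BDl BC Bpos.
have xb i : dot (x i) (vec b i) = 0.
  pose n i := dot (x i) (vec b i) *: x i.
  have n0 j : tangent_part n j = 0.
    by rewrite /tangent_part /n dotZr x_unit mulr1 subrr.
  have : B b (mx n) = 0.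
    rewrite /B vecK /linearized_form big1 // => j _; rewrite big1 // => l _; rewrite n0.
    have d0 (y : 'cV[R]_3) : dot y 0 = 0 by rewrite dotE !mxE; ring.
    by rewrite !d0 !mulr0 !subr0.
  rewrite Hb dotv => /eqP; rewrite mulf_eq0 gt_eqF //= psumr_eq0; last first.
    by move=> j _; rewrite /n dotZr dotC -expr2 sqr_ge0.
  move=> /allP/(_ i (mem_index_enum _)) /=.
  by rewrite /n dotZr dotC -expr2 sqrf_eq0 => /eqP.
exists mu, (vec b); split=> //.
  apply: contrapT => b0; move/negP: bN0; apply; apply/eqP/matrixP => i l.
  have : vec b i = 0 by apply/eqP/negPn/negP => bi; apply: b0; exists i.
  by move=> /matrixP/(_ l 0); rewrite !mxE.
move=> v xv; rewrite linearized_formC // -dotv -Hb /B vecK.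
by rewrite !tangentK.
Qed.

End AtUnitVectors.

End ReducedLinearization.

(** * From the axes to the full configuration space *)

(** The image of L - mu lies in the kernel of the nonzero functional l, so
    L - mu is not onto, hence not injective. *)
Lemma left_to_right_eigenvector (K : fieldType) (V : vectType K) (L : V -> V)
    (l : V -> K) (mu : K) (v0 : V) :
  linear L -> (forall v, l (L v) = mu * l v) ->
  (forall a u v, l (a *: u + v) = a * l u + l v) -> l v0 != 0 ->
  exists2 v, v != 0 & L v = mu *: v.
Proof.
move=> Llin lL llin lv0; pose S v := L v - mu *: v.
have Slin : linear S.
  move=> a u v; rewrite /S Llin scalerDr opprD addrACA scalerBr !scalerA.
  by rewrite [mu * a]mulrC.
pose Sl : {linear V -> V} := HB.pack S (GRing.isLinear.Build K V V *:%R S Slin).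
pose T := linfun Sl.
have lS v : l (S v) = 0.
  by rewrite /S addrC -scaleNr llin lL mulNr addNr.
have kerT : lker T != 0%VS.
  apply/eqP => /eqP T0; move/negP: lv0; apply; apply/eqP.
  have limT : limg T = fullv.
    apply/eqP; rewrite eqEdim subvf /=.
    by rewrite -(limg_dim_eq (f := T) (U := fullv)) //; rewrite (eqP T0) capv0.
  have : v0 \in limg T by rewrite limT memvf.
  by move=> /memv_imgP[v _ ->]; rewrite lfunE /= lS.
exists (vpick (lker T)); first by rewrite vpick0.
have := memv_pick (lker T); rewrite memv_ker lfunE /= => /eqP/eqP.
by rewrite /S subr_eq0 => /eqP.
Qed.

(** The linearizations A on M and B on M' need not be equal, but they agree on
    tangent vectors of M', where the unstable eigenvectors live. *)
Lemma exponentially_unstable_transfer (R : realType) m n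
    (M M' : set 'M[R]_(m, n)) (F G : 'M[R]_(m, n) -> 'M[R]_(m, n)) p :
  M' `<=` M -> (forall x, M' x -> F x = G x) -> linearizable M F p ->
  exponentially_unstable M' G p -> exponentially_unstable M F p.
Proof.
move=> M'M FG [A FA] [B GB [a [b [v [w [a0 tv tw vw [Bv Bw]]]]]]].
have tangentM u : tangent M' p u -> tangent M p u.
  by move=> [gam [g0 gM gu]]; exists gam; split=> // t; exact: M'M.
have AB u : tangent M' p u -> A u = B u.
  move=> [gam [g0 gM gu]].
  have FAu := linearization_curve FA g0 (fun t => M'M _ (gM t)) gu.
  have := linearization_curve GB g0 gM gu.
  have -> : (fun t => G (gam t)) = (fun t => F (gam t)).
    by apply/funext => t; rewrite FG.
  exact: is_derive_unique.
exists A => //; exists a, b, v, w; split=> //; try exact: tangentM.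
by rewrite !AB.
Qed.

Section Lifting.
Context (R : realType) (N : nat).
Context (p : config R N).
Hypothesis Sp : SO3N R N p.

(** Row i of W is the angular velocity of member i: a linear parametrization of
    the tangent space at p. *)
Definition rot_tangent (W : 'M[R]_(N, 3)) : config R N :=
  tuple_mx (fun i => spin (row i W)^T *m att p i).

Definition ang_velocity (V : config R N) : 'M[R]_(N, 3) :=
  \matrix_(i, l) unspin (att V i *m (att p i)^T) l 0.

Lemma rot_tangent_linear : linear rot_tangent.
Proof.
move=> a U W; apply: config_eqP => i; rewrite attD !att_tuple_mx !linearP /=.
by rewrite spinD spinZ mulmxDl scalemxAl.
Qed.

Lemma ang_velocity_linear : linear ang_velocity.
Proof.
have E V i l : ang_velocity V i l = unspin (att V i *m (att p i)^T) l 0 by rewrite mxE.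
have unspinD a Q Q' : unspin (a *: Q + Q') = a *: unspin Q + unspin Q' :> 'cV[R]_3.
  by apply: cv3P; rewrite !mxE.
move=> a U W; apply/matrixP => i l; rewrite !mx_coords !E attD mulmxDl -scalemxAl.
by rewrite unspinD !mx_coords.
Qed.

Lemma rot_tangentK : cancel rot_tangent ang_velocity.
Proof.
move=> W; apply/matrixP => i l.
by rewrite mxE att_tuple_mx -mulmxA (SO3_mulmxV (Sp i)) mulmx1 spinK !mxE.
Qed.

Lemma rot_tangent0 : rot_tangent 0 = 0.
Proof.
have := rot_tangent_linear 1 0 0; rewrite scaler0 addr0 scale1r => /eqP.
by rewrite -subr_eq0 opprD addNKr oppr_eq0 => /eqP.
Qed.

Lemma rot_tangentZ a W : rot_tangent (a *: W) = a *: rot_tangent W.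
Proof. by rewrite -[a *: W]addr0 rot_tangent_linear rot_tangent0 addr0. Qed.

(** The skewness condition characterizes the tangent space. *)
Lemma ang_velocityK V :
  (forall i, att V i *m (att p i)^T + (att V i *m (att p i)^T)^T = 0) ->
  rot_tangent (ang_velocity V) = V.
Proof.
move=> skew; apply: config_eqP => i; rewrite att_tuple_mx.
have -> : (row i (ang_velocity V))^T = unspin (att V i *m (att p i)^T).
  by apply/matrixP => l z; rewrite ord1 [LHS]mxE [LHS]mxE [LHS]mxE.
rewrite unspinK //; case: (Sp i) => QQ _.
by rewrite -mulmxA QQ mulmx1.
Qed.

Lemma xax_rot_tangent W i : xax (rot_tangent W) i = cross (row i W)^T (xax p i).
Proof. by rewrite /xax att_tuple_mx col_mulmx. Qed.

Definition rot_curve (W : 'M[R]_(N, 3)) (t : R) : config R N :=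
  tuple_mx (fun i => cayley ((t / 2) *: (row i W)^T) *m att p i).

Lemma rot_curve0 W : rot_curve W 0 = p.
Proof.
by apply: config_eqP => i; rewrite att_tuple_mx mul0r scale0r cayley0 mul1mx.
Qed.

Lemma rot_curve_SO3N W t : SO3N R N (rot_curve W t).
Proof.
move=> i; rewrite att_tuple_mx.
have [C1 C2] := cayley_SO3 ((t / 2) *: (row i W)^T); have [Q1 Q2] := Sp i.
split; last by rewrite det_mulmx C2 Q2 mulr1.
by rewrite trmx_mul mulmxA -(mulmxA _ _ (cayley _)) C1 mulmx1.
Qed.

Lemma rot_curve_derivative W :
  is_derive (0 : R) (1 : R) (rot_curve W) (rot_tangent W).
Proof.
apply: is_derive_tuple_mx => i.
have := is_derive_mulmx (is_derive_cayley (row i W)^T) (is_derive_cst (att p i) (0 : R) (1 : R)).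
by rewrite mulmx0 addr0.
Qed.

Lemma rot_tangent_tangent W : tangent (SO3N R N) p (rot_tangent W).
Proof.
exists (rot_curve W); split; [exact: rot_curve0|exact: rot_curve_SO3N|].
exact: rot_curve_derivative.
Qed.

Variables (e : rel 'I_N) (f : 'I_N -> 'I_N -> R -> R)
  (g : 'I_N -> 'I_N -> config R N -> R).
Hypotheses (e_sym : symmetric e)
  (f_der : forall i j, e i j -> forall s : R, is_derive s (1 : R) (f i j) (derive1 (f i j) s))
  (f_sym : forall i j, e i j -> forall s : R, 0 <= s -> s <= 2 -> f i j s = f j i s)
  (df_sym : forall i j, e i j -> forall s : R, 0 < s -> s <= 2 ->
     derive1 (f i j) s = derive1 (f j i) s)
  (f_gain : forall i j, e i j -> forall s : R, 0 < s -> s <= 2 ->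
     0 < s ^+ 2 * f i j s - (2 - s) * s ^+ 2 * derive1 (f i j) s).

Let F := closed_loop e f g.

Variable A : {linear config R N -> config R N}.
Hypotheses (FA : linearization (SO3N R N) F p A) (Fp : F p = 0).

Let FA_curve W : is_derive (0 : R) (1 : R) (fun t => F (rot_curve W t)) (A (rot_tangent W)).
Proof.
apply: (linearization_curve FA (rot_curve0 W)); first exact: rot_curve_SO3N.
exact: rot_curve_derivative.
Qed.

Lemma closed_loop_skew X i : SO3N R N X ->
  att (F X) i *m (att X i)^T + (att (F X) i *m (att X i)^T)^T = 0.
Proof.
move=> SX; rewrite /F att_tuple_mx -mulmxA (SO3_mulmxV (SX i)) mulmx1.
by rewrite spin_tr subrr.
Qed.

(** The linearization maps the tangent space to itself because F is a tangent
    field: differentiate the skewness of F R^T, using that F vanishes at p. *)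
Lemma linearization_skew W i :
  att (A (rot_tangent W)) i *m (att p i)^T +
  (att (A (rot_tangent W)) i *m (att p i)^T)^T = 0.
Proof.
have Qd := is_derive_att i (rot_curve_derivative W).
have Fd := is_derive_att i (FA_curve W).
have FQ := is_derive_mulmx Fd (is_derive_trmx Qd).
have := is_deriveD FQ (is_derive_trmx FQ).
have -> : (fun t => att (F (rot_curve W t)) i *m (att (rot_curve W t) i)^T) +
    (fun t => (att (F (rot_curve W t)) i *m (att (rot_curve W t) i)^T)^T) = cst 0.
  by apply/funext => t; exact: closed_loop_skew (rot_curve_SO3N W t).
move=> H; have := is_derive_unique H (is_derive_cst (0 : 'M[R]_3) (0 : R) (1 : R)).
have att0 : att (0 : config R N) i = 0 by rewrite /att !linear0.
by rewrite rot_curve0 Fp att0 mul0mx addr0.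
Qed.

Lemma linearization_xax W i :
  xax (A (rot_tangent W)) i = reduced_field_diff e f (xax p) (xax (rot_tangent W)) i.
Proof.
have xd j : is_derive (0 : R) (1 : R) (fun t => xax (rot_curve W t) j) (xax (rot_tangent W) j).
  exact: (is_derive_col 0 (is_derive_att j (rot_curve_derivative W))).
have Fd : is_derive (0 : R) (1 : R) (fun t => xax (F (rot_curve W t)) i) (xax (A (rot_tangent W)) i).
  exact: (is_derive_col 0 (is_derive_att i (FA_curve W))).
have Xd := is_derive_reduced_field f_der (x := fun t => xax (rot_curve W t)) i xd.
rewrite rot_curve0 in Xd; apply: is_derive_unique Fd _.
have -> : (fun t => xax (F (rot_curve W t)) i) =
    (fun t => reduced_field e f (xax (rot_curve W t)) i).
  by apply/funext => t; apply: xax_closed_loop; exact: rot_curve_SO3N.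
exact: Xd.
Qed.

(** The functional l, the inner product with b of the axis components, is a left
    eigenvector of the full linearization: axis components evolve autonomously,
    and their linearization is symmetric. *)
Lemma misaligned_exponentially_unstable i0 j0 : e i0 j0 -> xax p i0 <> xax p j0 ->
  exponentially_unstable (SO3N R N) F p.
Proof.
move=> eij xij; have x1 i := xax_unit i Sp.
have [mu [b [mu0 xb [k bk] Hb]]] :=
  linearized_form_eigenvector e_sym x1 f_sym df_sym f_gain eij xij.
pose l W := \sum_i dot (b i) (xax (rot_tangent W) i).
pose L W := ang_velocity (A (rot_tangent W)).
have AT W : rot_tangent (L W) = A (rot_tangent W).
  by apply: ang_velocityK => i; exact: linearization_skew.
have lL W : l (L W) = mu * l W.
  rewrite /l AT -Hb; last first.
    move=> i; rewrite xax_rot_tangent dotE !cross_coords; ring.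
  rewrite -(linearized_formE _ _ _ xb).
  by apply: eq_bigr => i _; rewrite linearization_xax.
have Llin : linear L.
  by move=> a U W; rewrite /L rot_tangent_linear linearP ang_velocity_linear.
have llin a U W : l (a *: U + W) = a * l U + l W.
  rewrite /l mulr_sumr -big_split; apply: eq_bigr => i _ /=.
  by rewrite rot_tangent_linear xaxD dotDr dotZr.
(* Rotating x_i with angular velocity x_i cross b_i moves it with velocity b_i,
   so l does not vanish on the tangent space. *)
pose W0 : 'M[R]_(N, 3) := \matrix_(i, m) cross (xax p i) (b i) m 0.
have W0x i : xax (rot_tangent W0) i = b i.
  rewrite xax_rot_tangent (_ : (row i W0)^T = cross (xax p i) (b i)).
    by rewrite cross_cross x1 scale1r dotC xb scale0r subr0.
  by apply/matrixP => m z; rewrite ord1 [LHS]mxE [LHS]mxE [LHS]mxE.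
have lW0 : l W0 != 0.
  rewrite /l psumr_eq0; last by move=> i _; rewrite W0x dot_ge0.
  apply/negP => /allP/(_ k (mem_index_enum _)); rewrite W0x => /eqP/dot_eq0 b0.
  by rewrite b0 eqxx in bk.
have [W WN0 LW] := left_to_right_eigenvector Llin lL llin lW0.
have AW : A (rot_tangent W) = mu *: rot_tangent W.
  by rewrite -AT LW rot_tangentZ.
exists A => //; exists mu, 0, (rot_tangent W), 0; split=> //.
- exact: rot_tangent_tangent.
- by exists (fun=> p); split=> //; exact: is_derive_cst.
- move=> [W0' _]; move/negP: WN0; apply; apply/eqP.
  by rewrite -(rot_tangentK W) W0' -rot_tangent0 rot_tangentK.
- by split; [rewrite AW scaler0 subr0|rewrite linear0 scale0r scaler0 addr0].
Qed.

End Lifting.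

Theorem theorem31 (R : realType) (N : nat) (e : rel 'I_N)
    (f : 'I_N -> 'I_N -> R -> R) (g : 'I_N -> 'I_N -> config R N -> R)
    (N_gt0 : (0 < N)%N)
    (e_sym : symmetric e) (e_irr : irreflexive e)
    (e_connected : forall i j, connect e i j)
    (f_analytic : forall i j, e i j -> real_analytic (f i j))
    (f_gain : forall i j, e i j -> forall s : R, 0 < s -> s <= 2 ->
      [/\ 0 < f i j s, f i j s = f j i s &
          0 < s ^+ 2 * f i j s - (2 - s) * s ^+ 2 * derive1 (f i j) s])
    (g_lipschitz : forall i j, e i j ->
      [locally [lipschitz g i j Y | Y in relinfo_dom e i]])
    (g_consensus : great_circle_almost_global_consensus e g)
    (g_unstable : forall X,
      equilibrium (aligned e) (great_circle e g) X -> ~ consensus e X ->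
      exponentially_unstable (aligned e) (great_circle e g) X) :
  (forall X,
    equilibrium (SO3N R N) (closed_loop e f g) X -> ~ consensus e X ->
    linearizable (SO3N R N) (closed_loop e f g) X ->
    exponentially_unstable (SO3N R N) (closed_loop e f g) X) /\
  asymptotically_stable (SO3N R N) (closed_loop e f g) (consensus e).
Proof.
have f_der i j : e i j -> forall s : R, is_derive s (1 : R) (f i j) (derive1 (f i j) s).
  by move=> eij s; apply: analytic_derivable; exact: f_analytic.
have f_cont i j : e i j -> continuous (f i j).
  by move=> eij s; exact: is_derive_continuous (f_der _ _ eij s).
have f_pos i j : e i j -> forall s : R, 0 < s -> s <= 2 -> 0 < f i j s.
  by move=> eij s s0 s2; case: (f_gain _ _ eij _ s0 s2).
have f_sym i j : e i j -> forall s : R, 0 <= s -> s <= 2 -> f i j s = f j i s.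
  move=> eij s; rewrite le_eqVlt => /predU1P[<- _|s0 s2]; last first.
    by case: (f_gain _ _ eij _ s0 s2).
  apply: (continuous_eq_right (@ltr0n R 2)); [exact: f_cont|by apply: f_cont; rewrite e_sym|].
  by move=> y y0; rewrite add0r => y2; case: (f_gain _ _ eij _ y0 y2).
have df_sym i j : e i j -> forall s : R, 0 < s -> s <= 2 ->
    derive1 (f i j) s = derive1 (f j i) s.
  move=> eij s s0 s2; have eji : e j i by rewrite e_sym.
  apply: (is_derive_eq_left s0 (f_der _ _ eij s) (f_der _ _ eji s)) => y.
  rewrite subrr => y0 ys; apply: f_sym => //; first exact: ltW.
  exact: le_trans s2.
have f_gain' i j : e i j -> forall s : R, 0 < s -> s <= 2 ->
    0 < s ^+ 2 * f i j s - (2 - s) * s ^+ 2 * derive1 (f i j) s.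
  by move=> eij s s0 s2; case: (f_gain _ _ eij _ s0 s2).
split; last first.
  apply: consensus_asymptotically_stable => //.
  by case: g_consensus.
move=> X [SX FX] XC [A FA].
have [al|nal] := pselect (forall i j, e i j -> xax X i = xax X j).
  apply: (@exponentially_unstable_transfer _ _ _ _ (aligned e) _ (great_circle e g)).
  - by move=> Y [].
  - exact: closed_loop_aligned.
  - by exists A.
  - apply: g_unstable => //; split; first by split.
    by rewrite -(closed_loop_aligned f g (conj SX al)).
have [i [j [eij xij]]] : exists i j, e i j /\ xax X i <> xax X j.
  apply: contrapT => H; apply: nal => i j eij.
  by apply: contrapT => xij; apply: H; exists i, j.
exact: (misaligned_exponentially_unstable SX e_sym f_der f_sym df_sym f_gain' FA FX eij xij).
Qed.
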